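(* Consider FRA-Poly Phase 1 applied to (D), with $\mathcal{K}=\mathcal{K}^1\times\cdots\times\mathcal{K}^r$. The following hold. (i) If (D) is feasible, then the output face $\mathcal{F}$ satisfies $\mathcal{F}_{\min}^D \subseteq \mathcal{F}$. Moreover, $s'$ is a dual feasible slack such that $s_j' \in \mathrm{ri}\, \mathcal{F}^j$ for every $j$ such that $\mathcal{F}^j$ is nonpolyhedral, i.e., the PPS condition is satisfied for $\mathcal{F}$. In this case, Phase 1 stops after finding at most $\sum_{i=1}^{r} \ell_{\text{poly}}(\mathcal{K}^i)$ directions. (ii) (D) is infeasible if and only if Step 3 is reached (i.e. the algorithm stops at Step 3). In this case, Phase 1 stops after finding at most $1+ \sum_{i=1}^{r} \ell_{\text{poly}}(\mathcal{K}^i)$ directions.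
   Context: Let $\mathcal{K}=\mathcal{K}^1\times\cdots\times\mathcal{K}^r\subseteq\mathbb{R}^n$ be a product of closed convex cones, $\mathcal{A}:\mathbb{R}^n\to\mathbb{R}^m$ linear with adjoint $\mathcal{A}^*$, $b\in\mathbb{R}^m$, $c\in\mathbb{R}^n$; a star on a cone denotes the dual cone. Problem (D) is $\sup\{\langle b,y\rangle : c-\mathcal{A}^*y\in\mathcal{K}\}$; $\mathcal{F}_{\min}^D$ is the minimal face of $\mathcal{K}$ containing the feasible slacks $\{c-\mathcal{A}^*y\in\mathcal{K}\}$ (empty if (D) is infeasible). Every face $\mathcal{F}$ of $\mathcal{K}$ is written $\mathcal{F}=\mathcal{F}^1\times\cdots\times\mathcal{F}^r$ with $\mathcal{F}^j$ a face of $\mathcal{K}^j$, and vectors are split into blocks accordingly. For a closed convex cone $\mathcal{C}\subseteq\mathbb{R}^n$ and $e,e^*\in\mathbb{R}^n$, consider the pair $(P_{\mathcal{C}})$: minimize $t$ over $(x,t,w)\in\mathcal{C}^*\times\mathbb{R}_+\times\mathbb{R}_+$ subject to $-\langle c,x-te^*\rangle+t-w=0$, $\langle e,x\rangle+w=1$, $\mathcal{A}x-t\mathcal{A}e^*=0$; $(D_{\mathcal{C}})$: maximize $y_2$ over $(y_1,y_2,y_3)\in\mathbb{R}\times\mathbb{R}\times\mathbb{R}^m$ subject to $cy_1-ey_2-\mathcal{A}^*y_3\in\mathcal{C}$, $1-y_1(1+\langle c,e^*\rangle)+\langle e^*,\mathcal{A}^*y_3\rangle\ge0$, $y_1-y_2\ge0$.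 FRA-Poly Phase 1: Step 1. $\mathcal{F}_1\leftarrow\mathcal{K}$, $i\leftarrow1$. Step 2. Let $(x^*,t^*,w^* )$ and $(y_1^*,y_2^*,y_3^* )$ be any pair of optimal solutions to $(P_{\mathcal{F}_i})$ and $(D_{\mathcal{F}_i})$, with any $e^*\in\mathrm{ri}\,\mathcal{F}_i^*$ and any $e=(e_1,\dots,e_r)$ such that $e_j=0$ if $\mathcal{F}_i^j$ is polyhedral and $e_j\in\mathrm{ri}\,\mathcal{F}_i^j$ otherwise. Step 3. If $t^*=0$ and $\langle c,x^*\rangle<0$, let $\mathcal{F}_{\min}^D\leftarrow\emptyset$ and stop; (D) is declared infeasible (here $x^*$ is counted as one of the directions found). Step 4. If $t^*=0$ and $\langle c,x^*\rangle=0$, let $d_i\leftarrow x^*$, $\mathcal{F}_{i+1}\leftarrow\mathcal{F}_i\cap\{d_i\}^\perp$, $i\leftarrow i+1$ and return to Step 2. Step 5. If $t^*>0$, let $s'\leftarrow c-\mathcal{A}^*\frac{y_3^*}{y_1^*}$, $\mathcal{F}\leftarrow\mathcal{F}_i$ and stop. PPS (partial polyhedral Slater) condition for a face $\mathcal{F}$: there is a slack $s=c-\mathcal{A}^*y\in\mathcal{F}$ with $s_j\in\mathrm{ri}\,\mathcal{F}^j$ for every $j$ with $\mathcal{F}^j$ nonpolyhedral. The distance to polyhedrality $\ell_{\text{poly}}(\mathcal{C})$ of a nonempty closed convex cone $\mathcal{C}$ is the length minus one of the longest strictly ascending chain of nonempty faces $\mathcal{F}_1\subsetneq\cdots\subsetneq\mathcal{F}_\ell$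 of $\mathcal{C}$ (length $\ell$) such that $\mathcal{F}_1$ is polyhedral and $\mathcal{F}_j$ is not polyhedral for all $j>1$. *)

(* Defs.v *)
(* MathComp / MathComp-Analysis. *)
From HB Require Import structures.
From mathcomp Require Import all_boot all_order all_algebra.
From mathcomp Require Import boolp classical_sets reals topology normedtype convex.

Set Implicit Arguments.
Unset Strict Implicit.
Unset Printing Implicit Defensive.

Import Order.TTheory GRing.Theory Num.Theory.
Import numFieldNormedType.Exports.
Local Open Scope classical_set_scope.
Local Open Scope ring_scope.

Definition dot (R : realType) (n : nat) (x y : 'cV[R]_n) : R :=
  \sum_(i < n) x i 0 * y i 0.

Section ConvexGeometry.
Context {R : realType} {n : nat}.
Implicit Types C F S : set 'cV[R]_n.

Definition affine_set S :=
  forall (x y : 'cV[R]_n) (t : R), S x -> S y -> S (t *: x + (1 - t) *: y).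

Definition affine_hull C : set 'cV[R]_n := smallest affine_set C.

Definition ri C : set 'cV[R]_n :=
  [set x | C x /\ within (affine_hull C) (nbhs x) C].

Definition closed_convex_cone C :=
  [/\ C !=set0, closed C, convex_set (C : set (convex_lmodType 'cV[R]_n)) &
      forall (a : R) (x : 'cV[R]_n), 0 <= a -> C x -> C (a *: x)].

Definition dual_cone C : set 'cV[R]_n :=
  [set x | forall y, C y -> 0 <= dot y x].

Definition orthogonal_to (d : 'cV[R]_n) : set 'cV[R]_n :=
  [set x | dot d x = 0].

Definition polyhedral C :=
  exists (k : nat) (M : 'M[R]_(k, n)) (d : 'cV[R]_k),
    C = [set x | forall i, (M *m x) i 0 <= d i 0].

(* The empty set is a face. *)
Definition face C F :=
  [/\ F `<=` C, convex_set (F : set (convex_lmodType 'cV[R]_n)) &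
      forall (x y : 'cV[R]_n) (t : R), C x -> C y -> 0 < t < 1 ->
        F (t *: x + (1 - t) *: y) -> F x /\ F y].

(* A chain G 0 < ... < G (l - 1) of length l. *)
Definition poly_chain C (G : nat -> set 'cV[R]_n) (l : nat) :=
  [/\ (0 < l)%N,
      forall i, (i < l)%N -> face C (G i) /\ G i !=set0,
      forall i, (i.+1 < l)%N -> G i `<` G i.+1,
      polyhedral (G 0%N) &
      forall i, (0 < i < l)%N -> ~ polyhedral (G i)].

(* The chains of a nonempty closed convex cone have bounded length (their
   dimensions increase strictly) and one of length 1 exists (the lineality
   space), so the default value 0 is not used there. *)
Definition dist_poly C : nat :=
  xget 0%N [set l | (exists G, poly_chain C G l.+1) /\
                    forall G k, poly_chain C G k -> (k <= l.+1)%N].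

End ConvexGeometry.

Section Blocks.
Context {R : realType} {r : nat} {n_ : 'I_r -> nat}.

Definition prod_cone (K_ : forall j, set 'cV[R]_(n_ j)) :
    set 'cV[R]_(\sum_j n_ j) :=
  [set x | forall j, K_ j (submxcol x j)].

(* The j-th factor of a nonempty product set is its j-th projection. *)
Definition block (F : set 'cV[R]_(\sum_j n_ j)) (j : 'I_r) :
    set 'cV[R]_(n_ j) :=
  [set submxcol x j | x in F].

End Blocks.
Arguments block {R r n_} F j _.

Section Phase1.
Context {R : realType} {r m : nat} {n_ : 'I_r -> nat}.
Local Notation N := (\sum_j n_ j)%N.
Local Notation vec := 'cV[R]_N.
(* A^T is the adjoint of A for [dot]. *)
Variables (A : 'M[R]_(m, N)) (c : vec).
Implicit Types (C F K : set vec) (e es : vec).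

Definition slack (y : 'cV[R]_m) : vec := c - A^T *m y.

Definition feasible_slacks K : set vec :=
  [set s | K s /\ exists y, s = slack y].

Definition D_feasible K := exists y, K (slack y).

Definition Fmin K : set vec := smallest (face K) (feasible_slacks K).

Definition ri_on_nonpoly F (s : vec) :=
  forall j, ~ polyhedral (block F j) -> ri (block F j) (submxcol s j).

Definition PPS F :=
  exists s, [/\ feasible_slacks F s & ri_on_nonpoly F s].

Definition PC_feasible C e es (z : vec * R * R) :=
  let: (x, t, w) := z in
  [/\ dual_cone C x, 0 <= t & 0 <= w] /\
  [/\ - dot c (x - t *: es) + t - w = 0,
      dot e x + w = 1 &
      A *m x - t *: (A *m es) = 0].

Definition PC_optimal C e es (z : vec * R * R) :=
  PC_feasible C e es z /\
  forall z', PC_feasible C e es z' -> z.1.2 <= z'.1.2.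

Definition DC_feasible C e es (z : R * R * 'cV[R]_m) :=
  let: (y1, y2, y3) := z in
  [/\ C (y1 *: c - y2 *: e - A^T *m y3),
      0 <= 1 - y1 * (1 + dot c es) + dot es (A^T *m y3) &
      0 <= y1 - y2].

Definition DC_optimal C e es (z : R * R * 'cV[R]_m) :=
  DC_feasible C e es z /\
  forall z', DC_feasible C e es z' -> z'.1.2 <= z.1.2.

Definition step2_e F e :=
  forall j, (polyhedral (block F j) -> submxcol e j = 0) /\
            (~ polyhedral (block F j) -> ri (block F j) (submxcol e j)).

Inductive outcome : Type :=
  | Stop3 (ds : seq vec)
  | Stop5 (F : set vec) (s' : vec) (ds : seq vec).

Definition directions (o : outcome) : seq vec :=
  match o with Stop3 ds => ds | Stop5 _ _ ds => ds end.

(* Step 2 is split in two: the choice of (e, e^* ), then that of a pair of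
   optimal solutions; [ds] lists the directions found so far. *)
Inductive state : Type :=
  | Iterate (F : set vec) (ds : seq vec)
  | Solve (F : set vec) (ds : seq vec) (e es : vec)
  | Test (F : set vec) (ds : seq vec) (p : vec * R * R) (d : R * R * 'cV[R]_m)
  | Stopped (o : outcome).

Inductive step : state -> state -> Prop :=
  | step2_choose F ds e es :
      ri (dual_cone F) es -> step2_e F e ->
      step (Iterate F ds) (Solve F ds e es)
  | step2_solve F ds e es p d :
      PC_optimal F e es p -> DC_optimal F e es d ->
      step (Solve F ds e es) (Test F ds p d)
  | step3 F ds x t w d :
      t = 0 -> dot c x < 0 ->
      step (Test F ds (x, t, w) d) (Stopped (Stop3 (rcons ds x)))
  | step4 F ds x t w d :
      t = 0 -> dot c x = 0 ->
      step (Test F ds (x, t, w) d)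
           (Iterate (F `&` orthogonal_to x) (rcons ds x))
  | step5 F ds x t w y1 y2 y3 :
      0 < t ->
      step (Test F ds (x, t, w) (y1, y2, y3))
           (Stopped (Stop5 F (slack (y1^-1 *: y3)) ds)).

(* Total correctness: whatever the choices made, the execution from the given
   state never gets stuck, is finite, and its outcome satisfies Q. *)
Inductive always_stops_with (Q : outcome -> Prop) : state -> Prop :=
  | always_stopped o : Q o -> always_stops_with Q (Stopped o)
  | always_step s s0 :
      step s s0 -> (forall s', step s s' -> always_stops_with Q s') ->
      always_stops_with Q s.

Definition phase1 K (Q : outcome -> Prop) :=
  always_stops_with Q (Iterate K [::]).

End Phase1.

(* Main.v *)
(** A linear image [T(Q)] of a closed convex cone is closed as soon as
    [ker T /\ Q] lies in [-Q], and adding a finitely generated cone to the image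
    only requires this for the [Q]-part of the kernel (Caratheodory exchange on
    the generators).  Applied to both problems of a conic pair, this gives
    attainment and zero gap.  For the pair (P_F), (D_F) the closedness
    conditions hold because [(t e^*, t, t)] with [t = 1 / (1 + <e, e^*>)] is a
    relative interior primal point, and because the polyhedral blocks, where
    [e] vanishes, have finitely generated duals.  Hence Step 2 can always be
    executed and [t^* = y_2^*].
    In Step 4 one has [<e, x^*> = 1], so [<e_j, x^*_j> <> 0] for some
    nonpolyhedral block, whose face shrinks strictly: a longest chain for the
    new face extends by the old one, so its distance to polyhedrality drops.
    The sum of these distances over the blocks is thus a termination measure,
    and it bounds the number of directions. *)
Require Import Defs.
From mathcomp Require Import all_boot all_order all_algebra.
From mathcomp Require Import boolp classical_sets functions reals topology.
From mathcomp Require Import normedtype convex derive interval_inference.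
From mathcomp Require Import ring lra.

Set Implicit Arguments.
Unset Strict Implicit.
Unset Printing Implicit Defensive.

Import Order.TTheory GRing.Theory Num.Def Num.Theory.
Import numFieldNormedType.Exports.
Local Open Scope classical_set_scope.
Local Open Scope ring_scope.

(** * Norm estimates, closedness and compactness for column vectors, and the bilinear form [dot] *)

Section Topology.
Context {R : realType}.

Lemma coord_le_norm p q (x : 'M[R]_(p, q)) i j : `|x i j| <= `|x|.
Proof.
rewrite [leRHS]/normr /= mx_normrE; apply/bigmax_geP; right => /=.
by exists (i, j).
Qed.

Lemma norm_leP p q (x : 'M[R]_(p, q)) e : 0 <= e ->
  reflect (forall i j, `|x i j| <= e) (`|x| <= e).
Proof.
move=> e0; apply: (iffP idP) => [xe i j|H].
  exact: le_trans (coord_le_norm _ _ _) xe.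
rewrite [leLHS]/normr /= mx_normrE; apply/bigmax_leP; split => [//|[i j] _].
exact: H.
Qed.

Lemma mulmx_bound p q (M : 'M[R]_(p, q)) :
  exists2 L, 0 < L & forall x : 'cV[R]_q, `|M *m x| <= L * `|x|.
Proof.
have s0 : 0 <= \sum_i \sum_j `|M i j|.
  by apply: sumr_ge0 => i _; apply: sumr_ge0.
exists (1 + \sum_i \sum_j `|M i j|) => [|x]; first by rewrite ltr_wpDr.
apply/norm_leP => [|i k]; first by rewrite mulr_ge0 ?addr_ge0.
rewrite mxE (le_trans (ler_norm_sum _ _ _)) //.
apply: (@le_trans _ _ ((\sum_j `|M i j|) * `|x|)).
  rewrite mulr_suml; apply: ler_sum => j _.
  by rewrite normrM ler_wpM2l // coord_le_norm.
rewrite ler_wpM2r // (bigD1 i) //= addrCA lerDl addr_ge0 //.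
by apply: sumr_ge0 => i' _; apply: sumr_ge0.
Qed.

Lemma closed_normP p q (S : set 'M[R]_(p, q)) :
  closed S <->
  forall x, (forall e, 0 < e -> exists2 y, S y & `|x - y| < e) -> S x.
Proof.
split=> [cS x H|H].
  apply: cS => B /nbhs_ballP[e /= e0 eB].
  have [y Sy xy] := H e e0; exists y; split=> //; apply: eB.
  by rewrite mx_norm_ball.
move=> x xS; apply: H => e e0.
have [y [Sy]] := xS _ (nbhsx_ballx x e e0).
by rewrite mx_norm_ball => xy; exists y.
Qed.

Lemma closed_mulmx_preimage p q (M : 'M[R]_(p, q)) (S : set 'cV[R]_p) :
  closed S -> closed [set x | S (M *m x)].
Proof.
move=> /closed_normP cS; apply/closed_normP => x H /=.
apply: cS => e e0; have [L L0 LM] := mulmx_bound M.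
have [|y Sy xy] := H (e / L); first by rewrite divr_gt0.
exists (M *m y) => //; rewrite -mulmxBr (le_lt_trans (LM _)) //.
by rewrite mulrC -ltr_pdivlMr.
Qed.

Lemma compact_cV p (S : set 'cV[R]_p) (r : R) :
  closed S -> (forall x, S x -> `|x| <= r) -> compact S.
Proof.
move=> /closed_normP cS Sr.
(* Closed bounded sets of row vectors are compact; transposition, an isometry for the sup norm,
   carries this over to columns. *)
have trn (a b : nat) (x : 'M[R]_(a, b)) : `|x^T| = `|x|.
  apply/eqP; rewrite eq_le; apply/andP; split; apply/norm_leP => // i j.
    by rewrite mxE coord_le_norm.
  by have := coord_le_norm (x^T) j i; rewrite mxE.
have -> : S = trmx @` [set x : 'rV[R]_p | S x^T].
  apply/seteqP; split=> x /=; first by exists x^T; rewrite ?trmxK.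
  by case=> y Sy <-.
apply: continuous_compact.
  apply: continuous_subspaceT => x A /nbhs_ballP[e /= e0 eA].
  apply/nbhs_ballP; exists e => //= y; rewrite mx_norm_ball /= => xy.
  by apply: eA; rewrite mx_norm_ball /ball_ /= -raddfB trn.
apply: bounded_closed_compact.
  exists r; split; first exact: num_real.
  by move=> M rM x /= /Sr; rewrite trn => xr; rewrite (le_trans xr) // ltW.
apply/closed_normP => x H /=; apply: cS => e /H[y Sy xy].
by exists y^T => //; rewrite -raddfB trn.
Qed.

Lemma dotC n (x y : 'cV[R]_n) : dot x y = dot y x.
Proof. by apply: eq_bigr => i _; rewrite mulrC. Qed.

Lemma dotE n (x y : 'cV[R]_n) : dot x y = (x^T *m y) 0 0.
Proof. by rewrite mxE; apply: eq_bigr => i _; rewrite mxE. Qed.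

Lemma dotDl n (x x' y : 'cV[R]_n) : dot (x + x') y = dot x y + dot x' y.
Proof. by rewrite !dotE linearD mulmxDl mxE. Qed.

Lemma dotZl n a (x y : 'cV[R]_n) : dot (a *: x) y = a * dot x y.
Proof. by rewrite !dotE linearZ -scalemxAl mxE. Qed.

Lemma dotNl n (x y : 'cV[R]_n) : dot (- x) y = - dot x y.
Proof. by rewrite -scaleN1r dotZl mulN1r. Qed.

Lemma dotBl n (x x' y : 'cV[R]_n) : dot (x - x') y = dot x y - dot x' y.
Proof. by rewrite dotDl dotNl. Qed.

Lemma dot0l n (y : 'cV[R]_n) : dot 0 y = 0.
Proof. by rewrite -(scale0r 0) dotZl mul0r. Qed.

Lemma dotDr n (x y y' : 'cV[R]_n) : dot x (y + y') = dot x y + dot x y'.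
Proof. by rewrite !(dotC x) dotDl. Qed.

Lemma dotZr n a (x y : 'cV[R]_n) : dot x (a *: y) = a * dot x y.
Proof. by rewrite !(dotC x) dotZl. Qed.

Lemma dotNr n (x y : 'cV[R]_n) : dot x (- y) = - dot x y.
Proof. by rewrite !(dotC x) dotNl. Qed.

Lemma dotBr n (x y y' : 'cV[R]_n) : dot x (y - y') = dot x y - dot x y'.
Proof. by rewrite !(dotC x) dotBl. Qed.

Lemma dot0r n (y : 'cV[R]_n) : dot y 0 = 0.
Proof. by rewrite dotC dot0l. Qed.

Lemma dot_mull p q (M : 'M[R]_(p, q)) x y : dot (M *m x) y = dot x (M^T *m y).
Proof. by rewrite !dotE trmx_mul mulmxA. Qed.

Lemma dot_col_mx p q (x x' : 'cV[R]_p) (y y' : 'cV[R]_q) :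
  dot (col_mx x y) (col_mx x' y') = dot x x' + dot y y'.
Proof. by rewrite !dotE tr_col_mx mul_row_col mxE. Qed.

Lemma dot_scalar (a b : R) : dot (a%:M : 'cV_1) b%:M = a * b.
Proof. by rewrite /dot big_ord1 !mxE eqxx !mulr1n. Qed.

Lemma dot_ge0 n (x : 'cV[R]_n) : 0 <= dot x x.
Proof. by apply: sumr_ge0 => i _; rewrite -expr2 sqr_ge0. Qed.

Lemma dot_eq0 n (x : 'cV[R]_n) : dot x x = 0 -> x = 0.
Proof.
move=> /eqP; rewrite psumr_eq0 => [/allP H|i _]; last by rewrite -expr2 sqr_ge0.
apply/colP => i; rewrite mxE; apply/eqP.
by have := H i (mem_index_enum _); rewrite /= mulf_eq0 orbb.
Qed.

Lemma dot_gt0 n (x : 'cV[R]_n) : x != 0 -> 0 < dot x x.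
Proof.
by move=> x0; rewrite lt_def dot_ge0 andbT; apply: contra_neq x0 => /dot_eq0.
Qed.

Lemma dot_norm_le n (x y : 'cV[R]_n) : `|dot x y| <= n%:R * `|x| * `|y|.
Proof.
rewrite (le_trans (ler_norm_sum _ _ _)) // -mulrA mulr_natl.
have -> : `|x| * `|y| *+ n = \sum_(i < n) `|x| * `|y|.
  by rewrite sumr_const card_ord.
by apply: ler_sum => i _; rewrite normrM ler_pM // coord_le_norm.
Qed.

Lemma continuous_sum (X : topologicalType) I (s : seq I) (f : I -> X -> R) x :
  (forall i, {for x, continuous (f i)}) ->
  {for x, continuous (fun x => \sum_(i <- s) f i x)}.
Proof.
move=> cf; apply: cvg_big => [|i _]; last exact: cf.
exact: pseudometric_normed_Zmodule.add_continuous.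
Qed.

(** The squared Euclidean distance is continuous and [S] is compact. With [T] the identity this
    yields nearest points; with general [T] it turns approximation by an image into attainment. *)
Lemma min_dist_image p q (T : 'M[R]_(p, q)) (z : 'cV[R]_p)
    (S : set 'cV[R]_q) r :
  closed S -> S !=set0 -> (forall x, S x -> `|x| <= r) ->
  exists2 x, S x & forall y, S y ->
    dot (T *m x - z) (T *m x - z) <= dot (T *m y - z) (T *m y - z).
Proof.
move=> cS S0 Sr.
have [|c cS' Hc] := @compact_EVT_min 'cV[R]_q R
    (fun x => dot (T *m x - z) (T *m x - z)) S S0 (compact_cV cS Sr).
  apply: continuous_subspaceT => x.
  have lin i : {for x, continuous (fun x : 'cV[R]_q => (T *m x - z) i 0)}.
    have -> : (fun x : 'cV[R]_q => (T *m x - z) i 0) =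
              (fun x => \sum_j T i j * x j 0) \- cst (z i 0).
      by apply/funext => y; rewrite !mxE.
    apply: continuousB; last exact: cst_continuous.
    apply: continuous_sum => j; apply: continuousM; first exact: cst_continuous.
    exact: coord_continuous.
  by apply: continuous_sum => i; apply: continuousM; exact: lin.
exists c; first by rewrite inE in cS'.
by move=> y Sy; apply: Hc; rewrite inE.
Qed.

End Topology.

(** * Closed convex cones: closed linear images, separation, bipolarity *)

Section Cones.
Context {R : realType}.

(** Working form of [closed_convex_cone] (see [closed_convex_coneP]), with sums in place of convex
    combinations. *)
Definition ccone n (C : set 'cV[R]_n) :=
  [/\ closed C, C 0, forall x y, C x -> C y -> C (x + y) &
      forall (a : R) x, 0 <= a -> C x -> C (a *: x)].

Lemma convex_setP n (C : set 'cV[R]_n) :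
  convex_set (C : set (convex_lmodType 'cV[R]_n)) <->
  forall (x y : 'cV[R]_n) (t : R), 0 < t < 1 -> C x -> C y ->
    C (t *: x + (1 - t) *: y).
Proof.
rewrite convex_setW; split=> [H x y t /andP[t0 t1] Cx Cy|H x y].
  have t01 : 0 <= t <= 1 by rewrite !ltW.
  have := H x y; rewrite !inE => /(_ Cx Cy (Itv01 (ltW t0) (ltW t1))).
  by rewrite inE; apply.
rewrite !inE => Cx Cy k k0 k1; rewrite inE; apply: H => //.
by rewrite k0.
Qed.

Lemma closed_convex_coneP n (C : set 'cV[R]_n) :
  closed_convex_cone C <-> ccone C.
Proof.
split=> [[[x Cx] cC /convex_setP cvC CZ]|[cC C0 CD CZ]].
  split=> // [|y z Cy Cz]; first by rewrite -(scale0r x); apply: CZ.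
  have -> : y + z = 2 *: (2^-1 *: y + (1 - 2^-1) *: z).
    have -> : 1 - 2^-1 = 2^-1 :> R by field.
    by rewrite -scalerDr scalerA divff ?scale1r.
  by apply: CZ => //; apply: cvC => //; apply/andP; split; lra.
split=> //; first by exists 0.
apply/convex_setP => x y t /andP[t0 t1] Cx Cy.
by apply: CD; apply: CZ => //; lra.
Qed.

Definition lin_subspace n (S : set 'cV[R]_n) :=
  S 0 /\ forall a x y, S x -> S y -> S (a *: x + y).

(** [B] has maximal rank among the matrices whose row space lies in [S]. Adjoining a row [x^T] with
    [x] in [S] keeps the row space in [S], so it cannot raise the rank. *)
Lemma subspace_mx n (S : set 'cV[R]_n) : lin_subspace S ->
  exists B : 'M[R]_n, forall x, S x <-> (x^T <= B)%MS.
Proof.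
move=> [S0 Sl].
have SZ a x : S x -> S (a *: x) by move=> Sx; rewrite -[_ *: _]addr0; apply: Sl.
pose good k := `[< exists2 B : 'M[R]_n, (forall x, (x^T <= B)%MS -> S x) &
                                        \rank B = k >].
have ex0 : exists k, good k.
  exists 0%N; apply/asboolP; exists 0; last by rewrite mxrank0.
  by move=> x; rewrite submx0 => /eqP x0; rewrite -(trmxK x) x0 trmx0.
have ub k : good k -> (k <= n)%N.
  by move=> /asboolP[B _ <-]; exact: rank_leq_row.
have [k /asboolP[B BS rB] kmax] := ex_maxnP ex0 ub.
exists B => x; split=> [Sx|]; last exact: BS.
have : good (\rank (B + x^T)%MS).
  apply/asboolP; exists (B + x^T)%MS => // y /sub_addsmxP[[u v] /= yE].
  rewrite -(trmxK y) yE linearD /= addrC [v]mx11_scalar mul_scalar_mx.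
  rewrite linearZ /= trmxK; apply: Sl => //; apply: BS.
  by rewrite trmxK submxMl.
move=> /kmax; rewrite -rB => le.
have := mxrank_leqif_sup (addsmxSl B x^T).
rewrite addsmx_sub submx_refl /= => -[le' <-].
by rewrite eqn_leq le' le.
Qed.

Lemma subspace_proj n (S : set 'cV[R]_n) : lin_subspace S ->
  exists P : 'M[R]_n, (forall x, S (P *m x)) /\ (forall x, S x -> P *m x = x).
Proof.
move=> /subspace_mx[B SB]; exists (pinvmx B *m B)^T; split=> x.
  by apply/SB; rewrite trmx_mul trmxK mulmxA submxMl.
move=> /SB xB; rewrite -[LHS]trmxK trmx_mul trmxK mulmxA mulmxKpV //.
exact: trmxK.
Qed.

Lemma norm_le_sqrt_dot n (x : 'cV[R]_n) : `|x| <= Num.sqrt (dot x x).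
Proof.
apply/norm_leP => [|i j]; first exact: sqrtr_ge0.
rewrite -sqrtr_sqr ler_wsqrtr // ord1 /dot (bigD1 i) //= -expr2 lerDl.
by apply: sumr_ge0 => k _; rewrite -expr2 sqr_ge0.
Qed.

Lemma closed_norm_le n (r : R) : closed [set x : 'cV[R]_n | `|x| <= r].
Proof.
apply: ((continuous_closedP (fun x : 'cV[R]_n => `|x|)).1 _ [set x | x <= r]).
  exact: norm_continuous.
exact: closed_le.
Qed.

Lemma closed_norm_ge n (r : R) : closed [set x : 'cV[R]_n | r <= `|x|].
Proof.
apply: ((continuous_closedP (fun x : 'cV[R]_n => `|x|)).1 _ [set x | r <= x]).
  exact: norm_continuous.
exact: closed_ge.
Qed.

Lemma closed_coord n i (D : set R) :
  closed D -> closed [set x : 'cV[R]_n | D (x i 0)].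
Proof.
apply: ((continuous_closedP (fun x : 'cV[R]_n => x i 0)).1 _ D).
exact: coord_continuous.
Qed.

Lemma closed_set0E n : closed [set 0 : 'cV[R]_n].
Proof.
have -> : [set 0 : 'cV[R]_n] = [set x | `|x| <= 0].
  by apply/seteqP; split=> x /=; rewrite normr_le0 => /eqP.
exact: closed_norm_le.
Qed.

Lemma closed_forall n (I : Type) (S : I -> set 'cV[R]_n) :
  (forall i, closed (S i)) -> closed [set x | forall i, S i x].
Proof.
move=> cS; have -> : [set x | forall i, S i x] = \bigcap_(i in setT) S i.
  by apply/seteqP; split=> [x H i _|x H i]; [exact: H | exact: (H i)].
by apply: closed_bigI.
Qed.

Lemma dot_eps_eq0 p (v : 'cV[R]_p) :
  (forall e, 0 < e <= 1 -> dot v v <= p%:R * e) -> v = 0.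
Proof.
move=> H; apply/dot_eq0/eqP; rewrite eq_le dot_ge0 andbT leNgt.
apply/negP => d0.
have p0 : 0 <= p%:R :> R by [].
(* With [d = <v, v>], the choice [e = d / (p + d + 1)] is below 1, and [d <= p e] would give
   [d + 1 <= 0]. *)
have k0 : 0 < p%:R + dot v v + 1 by lra.
have := H (dot v v / (p%:R + dot v v + 1)).
rewrite divr_gt0 //= ler_pdivrMr // mul1r => /(_ ltac:(lra)).
rewrite mulrA ler_pdivlMr //; nra.
Qed.

(** The kernel of [T] inside [Q] is a linear subspace by the hypothesis. Projecting it away keeps
    points in [Q] and preserves their images; on the remaining cone [Q1] the map is injective at 0,
    so by compactness preimages are controlled by their images. Points of the image near [z] then
    have preimages in a fixed bounded set. *)
Lemma closed_image_pointed p q (T : 'M[R]_(p, q)) (Q : set 'cV[R]_q) :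
  ccone Q -> (forall x, Q x -> T *m x = 0 -> Q (- x)) ->
  closed [set z | exists2 x, Q x & T *m x = z].
Proof.
move=> [cQ Q0 QD QZ] QN.
have [|P [P1 P2]] := @subspace_proj q [set x | Q x /\ T *m x = 0].
  split; first by split; rewrite ?mulmx0.
  move=> a x y [Qx Tx] [Qy Ty]; split; last first.
    by rewrite linearD linearZ /= Tx Ty scaler0 addr0.
  apply: QD => //; have [a0|a0] := leP 0 a; first exact: QZ.
  rewrite -[a]opprK scaleNr -scalerN; apply: QZ; last exact: QN.
  by rewrite oppr_ge0 ltW.
pose Q1 := Q `&` [set x | P *m x = 0].
have cQ1 : closed Q1.
  by apply: closedI => //; apply: closed_mulmx_preimage (@closed_set0E _).
have toQ1 x : Q x -> Q1 (x - P *m x) /\ T *m (x - P *m x) = T *m x.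
  move=> Qx; have [QP TP] := P1 x; split; last by rewrite mulmxBr TP subr0.
  split; first by apply: QD => //; apply: QN.
  by rewrite /= mulmxBr (P2 (P *m x)) ?subrr.
(* [K] is the inverse of the minimum of [<Tx, Tx>] over the unit sphere of [Q1], positive because
   [P x = x] on the kernel while [P x = 0] on [Q1]. If that sphere is empty, [Q1] is reduced to 0
   and [K = 0] serves. *)
have [K K0 HK] : exists2 K, 0 <= K & forall x, Q1 x ->
    `|x| ^+ 2 <= K * dot (T *m x) (T *m x).
  pose S := Q1 `&` ([set x | `|x| <= 1] `&` [set x | 1 <= `|x|]).
  have cS : closed S.
    apply: closedI => //; apply: closedI; first exact: closed_norm_le.
    exact: closed_norm_ge.
  have scal x : Q1 x -> x != 0 -> S (`|x|^-1 *: x).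
    move=> [Qx Px] x0.
    have nx : 0 < `|x| by rewrite normr_gt0.
    split; first split.
    - by apply: QZ; rewrite // invr_ge0.
    - by rewrite /= -scalemxAr Px scaler0.
    by split; rewrite /= normrZ normfV normr_id mulVf ?lt0r_neq0 // lexx.
  have [S0|] := pselect (S !=set0); last first.
    move=> S0; exists 0 => // x Qx; have [->|x0] := eqVneq x 0.
      by rewrite normr0 expr0n mul0r.
    by case: S0; exists (`|x|^-1 *: x); exact: scal.
  have [|c [[Qc Pc] [_ /= c1]] Hc] := @min_dist_image _ _ _ T 0 _ 1 cS S0.
    by move=> x [_ [? _]].
  have d0 : 0 < dot (T *m c) (T *m c).
    apply: dot_gt0; apply/negP => /eqP Tc.
    move: Pc; rewrite /= P2 // => c0; move: c1; rewrite c0 normr0; lra.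
  exists (dot (T *m c) (T *m c))^-1; first by rewrite invr_ge0 ltW.
  move=> x Qx; have [->|x0] := eqVneq x 0.
    by rewrite normr0 expr0n mulmx0 dot0l mulr0.
  have nx : 0 < `|x| by rewrite normr_gt0.
  have := Hc _ (scal x Qx x0); rewrite !subr0 -scalemxAr dotZl dotZr mulrA.
  rewrite ler_pdivlMl // -invfM ler_pdivlMl ?mulr_gt0 //.
  by rewrite mulrC expr2.
apply/closed_normP => z Hz /=.
(* [B] dominates [K <y, y>] for all [y] with norm at most [|z| + 1]; then [|x|^2 <= B] forces
   [|x| <= 1 + B]. *)
pose B := K * (p%:R * (`|z| + 1) * (`|z| + 1)).
have B0 : 0 <= B by rewrite !mulr_ge0 // addr_ge0.
pose S := Q1 `&` [set x | `|x| <= 1 + B].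
have cS : closed S by apply: closedI => //; exact: closed_norm_le.
have S0 : S !=set0.
  exists 0; split; last by rewrite /= normr0; lra.
  by split; rewrite //= mulmx0.
have [|c [[Qc _] _] Hc] := @min_dist_image _ _ _ T z _ (1 + B) cS S0.
  by move=> x [].
(* The minimizer [c] is mapped to [z] itself: its squared distance to [z] is at most [p e] for every
   [e] in []0, 1]]. *)
exists c => //; apply/eqP; rewrite -subr_eq0; apply/eqP.
apply: dot_eps_eq0 => e /andP[e0 e1].
have [y [x Qx Txy] zy] := Hz e e0.
have [Q1x TT] := toQ1 x Qx; rewrite Txy in TT.
set x' := x - P *m x in Q1x TT.
have yz : `|y| <= `|z| + 1.
  have -> : y = z - (z - y) by rewrite opprB addrC subrK.
  by rewrite (le_trans (ler_normB _ _)) // lerD2l; lra.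
have Sx' : S x'.
  split=> //=; have := HK x' Q1x; rewrite TT.
  have : K * dot y y <= B.
    rewrite ler_wpM2l // (le_trans (ler_norm _)) //.
    rewrite (le_trans (dot_norm_le _ _)) // -!mulrA ler_wpM2l //.
    by rewrite ler_pM.
  have := normr_ge0 x'; nra.
apply: le_trans (Hc x' Sx') _; rewrite TT.
rewrite (le_trans (ler_norm _)) // (le_trans (dot_norm_le _ _)) //.
rewrite -mulrA ler_wpM2l // distrC.
have := normr_ge0 (z - y); nra.
Qed.

Lemma nonneg_of_quadratic (a b : R) : 0 <= b ->
  (forall t, 0 < t <= 1 -> 0 <= 2 * t * a + t ^+ 2 * b) -> 0 <= a.
Proof.
move=> b0 H; rewrite leNgt; apply/negP => a0.
(* If [a < 0], then [t = - a / (b + 1 - a)] lies in []0, 1]] and [t b < - a], so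
   [2 a + t b < a < 0]. *)
have k0 : 0 < b + 1 - a by lra.
have := H (- a / (b + 1 - a)).
have t0 : 0 < - a / (b + 1 - a) by rewrite divr_gt0 // oppr_gt0.
rewrite t0 ler_pdivrMr // mul1r => /(_ ltac:(lra)).
have tE : - a / (b + 1 - a) * (b + 1 - a) = - a by rewrite divfK // gt_eqF.
move: t0 tE; set t := - a / _ => t0 tE.
nra.
Qed.

Lemma dot_sqr_expand n (y g : 'cV[R]_n) t :
  dot (y + t *: g) (y + t *: g) =
  dot y y + (2 * t * dot g y + t ^+ 2 * dot g g).
Proof. rewrite !(dotDl, dotDr, dotZl, dotZr) (dotC y g); ring. Qed.

(** The separating vector is [y = g0 - p], with [g0] the point of [G] nearest to [p]. Moving from
    [g0] along [g] in [G] gives [<g, y> >= 0]; shrinking [g0] gives [<g0, y> = 0], hence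
    [<p, y> = - <y, y>]. *)
Lemma separation n (G : set 'cV[R]_n) (p : 'cV[R]_n) : ccone G -> ~ G p ->
  exists y, (forall g, G g -> 0 <= dot g y) /\ dot p y < 0.
Proof.
move=> [cG G0 GD GZ] Gp.
(* A point of [G] of norm above [r] is farther from [p] than 0 is, so minimizing over the bounded
   part [S] suffices. *)
pose r := `|p| + Num.sqrt (dot p p).
pose S := G `&` [set x | `|x| <= r].
have cS : closed S by apply: closedI => //; exact: closed_norm_le.
have S0 : S 0 by split; rewrite //= normr0 addr_ge0 ?sqrtr_ge0.
have [||g0 [Gg0 _] Hc] := @min_dist_image _ _ _ 1%:M p S r cS.
- by exists 0.
- by move=> x [].
have Hg g : G g -> dot (g0 - p) (g0 - p) <= dot (g - p) (g - p).
  move=> Gg; have [gr|gr] := leP `|g| r.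
    by have := Hc g; rewrite !mul1mx; apply.
  apply: (@le_trans _ _ (dot p p)).
    by have := Hc 0 S0; rewrite !mul1mx sub0r dotNl dotNr opprK.
  have h : Num.sqrt (dot p p) < `|g - p|.
    have := lerB_dist g p; rewrite /r in gr; lra.
  have := lt_le_trans h (norm_le_sqrt_dot _).
  by move=> /ltW; rewrite ler_sqrt ?dot_ge0.
pose y := g0 - p.
have expand g t : dot (g0 + t *: g - p) (g0 + t *: g - p) =
    dot y y + (2 * t * dot g y + t ^+ 2 * dot g g).
  have -> : g0 + t *: g - p = y + t *: g by rewrite /y addrAC.
  exact: dot_sqr_expand.
have Gy g : G g -> 0 <= dot g y.
  move=> Gg; apply: (nonneg_of_quadratic (dot_ge0 g)) => t /andP[t0 _].
  have : G (g0 + t *: g) by apply: GD => //; apply: GZ => //; exact: ltW.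
  by move=> /Hg; rewrite expand lerDl.
have g0y : dot g0 y = 0.
  apply/eqP; rewrite eq_le (Gy _ Gg0) andbT -oppr_ge0.
  apply: (nonneg_of_quadratic (dot_ge0 g0)) => t /andP[t0 t1].
  have : G (g0 + (- t) *: g0).
    by rewrite -{1}(scale1r g0) -scalerDl; apply: GZ => //; lra.
  move=> /Hg; rewrite expand lerDl; lra.
exists y; split=> //.
have -> : p = g0 - y by rewrite /y opprB addrC subrK.
rewrite dotBl g0y sub0r oppr_lt0; apply: dot_gt0.
by rewrite subr_eq0; apply/eqP => E; apply: Gp; rewrite -E.
Qed.

Lemma dual_cone_ccone n (C : set 'cV[R]_n) : ccone (dual_cone C).
Proof.
split=> [|y _|x y Cx Cy z Cz|a x a0 Cx z Cz].
- have -> : dual_cone C =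
      [set x | forall y, (fun x => C y -> 0 <= dot y x) x] by [].
  apply: closed_forall => y; have [Cy|Cy] := pselect (C y); last first.
    by have -> : (fun x => C y -> 0 <= dot y x) = setT by apply/seteqP; split.
  have -> : (fun x => C y -> 0 <= dot y x) =
      [set x | [set z : 'cV[R]_1 | 0 <= z 0 0] (y^T *m x)].
    by apply/seteqP; split=> x /=; rewrite dotE; first exact.
  apply: closed_mulmx_preimage; apply: (closed_coord (D := [set x | 0 <= x])).
  exact: closed_ge.
- by rewrite dot0r.
- by rewrite dotDr addr_ge0 // ?Cx ?Cy.
- by rewrite dotZr mulr_ge0 // Cx.
Qed.

Lemma bipolar n (C : set 'cV[R]_n) : ccone C -> dual_cone (dual_cone C) = C.
Proof.
move=> cC; apply/seteqP; split=> [z Hz|z Cz x Hx]; last first.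
  by rewrite dotC; apply: Hx.
apply: contrapT => /(separation cC)[y [Gy zy]].
by have := Hz y Gy; rewrite dotC leNgt zy.
Qed.

(** Induction on the set [I] of generators allowed a nonzero coefficient. Either a kernel element
    involves some generator, and exchange writes the image as a finite union of images with fewer
    generators, or all kernel elements live in [Q], and [closed_image_pointed] applies to the
    product cone. *)
Lemma closed_image_gen p q k (T : 'M[R]_(p, q)) (W : 'M[R]_(p, k))
    (Q : set 'cV[R]_q) :
  ccone Q ->
  (forall x (l : 'cV[R]_k), Q x -> (forall i, 0 <= l i 0) ->
     T *m x + W *m l = 0 -> Q (- x)) ->
  closed [set z | exists x (l : 'cV[R]_k),
    [/\ Q x, forall i, 0 <= l i 0 & T *m x + W *m l = z]].
Proof.
move=> cQ QN.
pose pos (I : {set 'I_k}) (l : 'cV[R]_k) :=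
  forall i, 0 <= l i 0 /\ (i \notin I -> l i 0 = 0).
pose G I := [set z | exists x l, [/\ Q x, pos I l & T *m x + W *m l = z]].
have posW I l : pos I l -> forall i, 0 <= l i 0 by move=> H i; case: (H i).
suff cG n : forall I : {set 'I_k}, #|I| = n -> closed (G I).
  have -> : [set z | exists x (l : 'cV[R]_k),
      [/\ Q x, forall i, 0 <= l i 0 & T *m x + W *m l = z]] = G (finset xpredT).
    apply/seteqP; split=> z [x [l [Qx l0 E]]]; exists x, l; split=> //.
      by move=> i; rewrite inE.
    exact: posW l0.
  exact: cG erefl.
elim/ltn_ind: n => n IH I In.
have [[x0 [mu [Qx0 pmu mu0 Emu]]]|noex] := pselect (exists x mu,
       [/\ Q x, pos I mu, mu != 0 & T *m x + W *m mu = 0]).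
  have -> : G I = \bigcup_(i in [set i | i \in I]) G (I :\ i).
    apply/seteqP; split=> z; last first.
      move=> [i /= iI [x [l [Qx pl E]]]]; exists x, l; split=> // j.
      have [l0 lj] := pl j; split=> // jI.
      by apply: lj; rewrite !inE (negbTE jI) andbF.
    move=> [x [l [Qx pl E]]].
    have [j0 j0P] : exists j, mu j 0 > 0.
      apply: contrapT => H; case/eqP: mu0; apply/colP => i; rewrite mxE.
      apply/eqP; rewrite eq_le (posW _ _ pmu) andbT leNgt; apply/negP => h.
      by apply: H; exists i.
    case: (@arg_minP _ _ _ j0 (fun j => mu j 0 > 0)
                              (fun j => l j 0 / mu j 0) j0P).
    (* Ratio test: [t] is the largest multiple of [mu] that can be subtracted while keeping [l]
       nonnegative, and it cancels coordinate [i]. The [Q]-part stays in [Q] since [- x0] is in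
       [Q]. *)
    move=> i mi imin; pose t := l i 0 / mu i 0.
    have t0 : 0 <= t by rewrite divr_ge0 ?(posW _ _ pl) ?ltW.
    exists i => /=.
      apply: contraT => iI; have [_ /(_ iI) m0] := pmu i.
      by rewrite m0 ltxx in mi.
    exists (x - t *: x0), (l - t *: mu); split.
    - case: cQ => _ _ QD QZ; apply: QD => //; rewrite -scalerN; apply: QZ => //.
      exact: (QN x0 mu Qx0 (posW _ _ pmu) Emu).
    - move=> j; rewrite !mxE; have [lj0 lj] := pl j; have [mj0 mj] := pmu j.
      split.
        rewrite subr_ge0; have [mj1|mj1] := ltP 0 (mu j 0).
          by rewrite -ler_pdivlMr //; exact: imin.
        have -> : mu j 0 = 0 by apply/eqP; rewrite eq_le mj1 mj0.
        by rewrite mulr0.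
      rewrite !inE negb_and negbK => /orP[/eqP ->|jI].
        by rewrite /t divfK ?gt_eqF // subrr.
      by rewrite lj // mj // mulr0 subrr.
    - rewrite !mulmxBr -!scalemxAr addrACA -opprD -scalerDr Emu scaler0 subr0.
      exact: E.
  apply: closed_bigcup; first exact: cardinality.finite_finset.
  move=> i /= iI; apply: (IH #|I :\ i|) => //.
  by rewrite -In (cardsD1 i I) iI.
(* No kernel element has a nonzero generator part, so the kernel condition for [Q'] reduces to the
   one for [Q]. *)
pose Q' := [set u : 'cV[R]_(q + k) | Q (usubmx u) /\ pos I (dsubmx u)].
have -> : G I = [set z | exists2 u, Q' u & row_mx T W *m u = z].
  apply/seteqP; split=> z.
    move=> [x [l [Qx pl E]]]; exists (col_mx x l); last by rewrite mul_row_col.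
    by split; rewrite ?col_mxKu ?col_mxKd.
  move=> [u [Qu pu]]; rewrite -{1}(vsubmxK u) mul_row_col => E.
  by exists (usubmx u), (dsubmx u).
have [cQc Q0 QD QZ] := cQ.
have Q'E u : Q' u = (Q (row_mx 1%:M 0 *m u) /\ pos I (row_mx 0 1%:M *m u)).
  by rewrite -{2 3}(vsubmxK u) !mul_row_col !mul1mx !mul0mx addr0 add0r.
apply: closed_image_pointed.
  split.
  - have -> : Q' = [set u | Q (row_mx 1%:M 0 *m u)] `&`
                   [set u | pos I (row_mx 0 1%:M *m u)].
      by apply/seteqP; split=> u; rewrite Q'E.
    apply: closedI; apply: closed_mulmx_preimage => //.
    apply: closed_forall => i; apply: closedI.
      by apply: (closed_coord (D := [set x | 0 <= x])); exact: closed_ge.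
    have [iI|iI] := boolP (i \in I); last first.
      have -> : (fun l : 'cV[R]_k => true -> l i 0 = 0) =
          [set l : 'cV[R]_k | [set 0] (l i 0)].
        by apply/seteqP; split=> l /=; [exact|].
      apply: closed_coord.
      have -> : [set (0 : R)] = [set x | 0 <= x] `&` [set x | x <= 0].
        apply/seteqP; split=> x /=; first by move=> ->.
        by move=> [? ?]; apply/eqP; rewrite eq_le; apply/andP.
      by apply: closedI; [exact: closed_ge | exact: closed_le].
    have -> : (fun l : 'cV[R]_k => false -> l i 0 = 0) = setT.
      by apply/seteqP; split.
    exact: closedT.
  - by rewrite Q'E !mulmx0; split=> // i; rewrite mxE.
  - move=> u v; rewrite !Q'E !mulmxDr => -[Qu pu] [Qv pv]; split.
      exact: QD.
    move=> i; have [u0 uI] := pu i; have [v0 vI] := pv i; rewrite mxE.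
    by split=> [|iI]; [rewrite addr_ge0 | rewrite uI // vI // addr0].
  - move=> a u a0; rewrite !Q'E -!scalemxAr => -[Qu pu]; split.
      exact: QZ.
    move=> i; have [u0 uI] := pu i; rewrite mxE.
    by split=> [|iI]; [rewrite mulr_ge0 | rewrite uI // mulr0].
move=> u [Qu pu]; rewrite -{1}(vsubmxK u) mul_row_col => E.
have d0 : dsubmx u = 0.
  by apply: contrapT => /eqP d0; apply: noex; exists (usubmx u), (dsubmx u).
split; last by rewrite linearN /= d0 oppr0 => i; rewrite mxE.
rewrite linearN /=; apply: (QN _ (dsubmx u)) => //; exact: posW pu.
Qed.

End Cones.

(** * Attainment and zero gap for a conic pair in standard form *)

Section Duality.
Context {R : realType}.

Lemma weak_duality p q (K : set 'cV[R]_p) (B : 'M[R]_(q, p)) f b x y :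
  dual_cone K x -> B *m x = b -> K (f - B^T *m y) -> dot b y <= dot f x.
Proof.
move=> Kx <- /Kx; rewrite dotBl dot_mull trmxK subr_ge0.
by rewrite dotC.
Qed.

(** The set of pairs [(s + B^T y, <b, y> - l)], with [s] in [K] and [l >= 0], is closed: the
    recession hypothesis is exactly what [closed_image_gen] asks of the kernel. Weak duality makes
    the supremum finite, [(f, sup)] is a limit of points of this set, and a preimage of it is a
    maximizer. *)
Lemma dual_attained p q (K : set 'cV[R]_p) (B : 'M[R]_(q, p)) f b :
  ccone K ->
  (forall y, K (- (B^T *m y)) -> 0 <= dot b y -> K (B^T *m y)) ->
  (exists x, dual_cone K x /\ B *m x = b) ->
  (exists y, K (f - B^T *m y)) ->
  exists2 y, K (f - B^T *m y) &
    forall y', K (f - B^T *m y') -> dot b y' <= dot b y.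
Proof.
move=> [cK K0 KD KZ] Krec [x [Kx xb]] [y0 Ky0].
pose T : 'M[R]_(p + 1, p + q) :=
  col_mx (row_mx 1%:M B^T) (row_mx (0 : 'M_(1, p)) b^T).
pose W : 'M[R]_(p + 1, 1) := col_mx 0 (-1)%:M.
pose Q := [set u : 'cV[R]_(p + q) | K (usubmx u)].
have QE u : Q u = K (row_mx 1%:M 0 *m u).
  by rewrite -{2}(vsubmxK u) mul_row_col mul1mx mul0mx addr0.
have cQ : ccone Q.
  split.
  - have -> : Q = [set u | K (row_mx 1%:M 0 *m u)].
      by apply/seteqP; split=> u; rewrite QE.
    exact: closed_mulmx_preimage.
  - by rewrite QE mulmx0.
  - by move=> u v; rewrite !QE mulmxDr; exact: KD.
  - by move=> a u a0; rewrite !QE -scalemxAr; exact: KZ.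
have TE u l : T *m u + W *m l =
    col_mx (usubmx u + B^T *m dsubmx u) ((dot b (dsubmx u) - l 0 0)%:M).
  rewrite -{1}(vsubmxK u) !mul_col_mx !mul_row_col mul1mx !mul0mx add0r.
  rewrite add_col_mx addr0; congr col_mx.
  by rewrite [l]mx11_scalar -scalar_mxM [b^T *m _]mx11_scalar -dotE -rmorphD
     /= mxE eqxx mulr1n mulN1r.
have cl := @closed_image_gen R _ _ _ T W Q cQ.
pose V := [set v | exists2 y, K (f - B^T *m y) & dot b y = v].
have hasV : has_sup V.
  split; first by exists (dot b y0), y0.
  exists (dot f x) => _ [y Ky <-]; exact: (weak_duality Kx xb Ky).
have [||u [l [Qu l0]]] := (closed_normP _).1 (cl _) (col_mx f (sup V)%:M).
- move=> u l Qu l0; rewrite TE => /eqP.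
  rewrite col_mx_eq0 => /andP[/eqP Eu /eqP Es].
  have bl : dot b (dsubmx u) = l 0 0.
    move/matrixP: Es => /(_ 0 0); rewrite !mxE eqxx mulr1n => /eqP.
    by rewrite subr_eq0 => /eqP.
  have uE : usubmx u = - (B^T *m dsubmx u) by apply/eqP; rewrite -addr_eq0 Eu.
  rewrite /Q /= linearN /= uE opprK; apply: Krec; first by rewrite -uE.
  by rewrite bl l0.
- move=> e e0; have [_ [y Ky <-] ye] := sup_adherent e0 hasV.
  exists (col_mx f (dot b y)%:M).
    exists (col_mx (f - B^T *m y) y), 0; split => [|i|].
    + by rewrite /Q /= col_mxKu.
    + by rewrite mxE.
    + by rewrite TE col_mxKu col_mxKd subrK mxE subr0.
  rewrite opp_col_mx add_col_mx subrr -rmorphB /=.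
  have yV : dot b y <= sup V by apply: ub_le_sup; [exact: hasV.2 | exists y].
  apply: (@le_lt_trans _ _ (sup V - dot b y)); last lra.
  apply/norm_leP => [|i j]; first by rewrite subr_ge0.
  rewrite ord1 mxE; case: (fintype.split _) => a.
    by rewrite mxE normr0 subr_ge0.
  rewrite mxE.
  by rewrite ord1 eqxx mulr1n ger0_norm // subr_ge0.
rewrite TE => /eq_col_mx[Ef /matrixP/(_ 0 0)].
rewrite !mxE eqxx !mulr1n => Es.
exists (dsubmx u) => [|y' Ky'].
  by rewrite -Ef addrK.
have : dot b y' <= sup V by apply: ub_le_sup; [exact: hasV.2 | exists y'].
have := l0 0; lra.
Qed.

(* [K^* = Q + cone (columns of H)]: the finitely generated part of [K^*]
   needs no constraint qualification. *)
Lemma primal_attained p q k (K Q : set 'cV[R]_p) (H : 'M[R]_(p, k))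
    (B : 'M[R]_(q, p)) f b y :
  ccone K -> ccone Q ->
  (forall x, dual_cone K x <-> exists x' (l : 'cV[R]_k),
     [/\ Q x', forall i, 0 <= l i 0 & x' + H *m l = x]) ->
  (forall x' (l : 'cV[R]_k), Q x' -> (forall i, 0 <= l i 0) ->
     B *m (x' + H *m l) = 0 -> dot f (x' + H *m l) <= 0 -> Q (- x')) ->
  K (f - B^T *m y) ->
  (forall y', K (f - B^T *m y') -> dot b y' <= dot b y) ->
  exists x, [/\ dual_cone K x, B *m x = b & dot f x = dot b y].
Proof.
move=> cK cQ KQ Qrec Ky ymax.
have [_ K0 KD KZ] := cK.
pose T : 'M[R]_(q + 1, p) := col_mx B f^T.
pose W : 'M[R]_(q + 1, k + 1) :=
  col_mx (row_mx (B *m H) 0) (row_mx (f^T *m H) 1%:M).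
(* [G] collects the pairs formed by a right-hand side and an upper bound on the cost of reaching it.
   It is a closed cone, and the goal becomes that it contains [(b, <b, y>)]. *)
pose G : set 'cV[R]_(q + 1) := [set z | exists x s,
  [/\ dual_cone K x, 0 <= s & col_mx (B *m x) (dot f x + s)%:M = z]].
have TE x l : T *m x + W *m l =
    col_mx (B *m (x + H *m usubmx l))
           (dot f (x + H *m usubmx l) + dsubmx l 0 0)%:M.
  rewrite -{1}(vsubmxK l) !mul_col_mx !mul_row_col mul1mx !mul0mx addr0.
  rewrite add_col_mx -!mulmxA -mulmxDr addrA -mulmxDr; congr col_mx.
  by rewrite [f^T *m _]mx11_scalar -dotE {1}[dsubmx l]mx11_scalar -rmorphD.
have cG : ccone G.
  split.
  - have -> : G = [set z | exists x (l : 'cV[R]_(k + 1)),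
        [/\ Q x, forall i, 0 <= l i 0 & T *m x + W *m l = z]].
      apply/seteqP; split=> z.
        move=> [x [s [/KQ[x' [l [Qx' l0 <-]]] s0 <-]]].
        exists x', (col_mx l s%:M); split=> // [i|].
          rewrite mxE; case: (fintype.split _) => j //.
          by rewrite mxE ord1 eqxx mulr1n.
        by rewrite TE col_mxKu col_mxKd mxE eqxx mulr1n.
      move=> [x [l [Qx l0 <-]]]; rewrite TE.
      exists (x + H *m usubmx l), (dsubmx l 0 0); split=> //.
        apply/KQ; exists x, (usubmx l); split=> // i; rewrite mxE; exact: l0.
      by rewrite mxE; exact: l0.
    apply: closed_image_gen => // x l Qx l0; rewrite TE => /eqP.
    rewrite col_mx_eq0 => /andP[/eqP EB /eqP Es].
    apply: (Qrec x (usubmx l)) => // [i|]; first by rewrite mxE; exact: l0.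
    move/matrixP: Es => /(_ 0 0); rewrite !mxE eqxx mulr1n.
    have := l0 (rshift k 0); lra.
  - exists 0, 0; split=> //; first by case: (dual_cone_ccone K).
    by rewrite mulmx0 dot0r addr0 raddf0 col_mx0.
  - move=> _ _ [x [s [Kx s0 <-]]] [x' [s' [Kx' s0' <-]]].
    exists (x + x'), (s + s'); split.
    + by case: (dual_cone_ccone K) => _ _ D _; exact: D.
    + exact: addr_ge0.
    + by rewrite add_col_mx mulmxDr dotDr -rmorphD /= addrACA.
  - move=> a _ a0 [x [s [Kx s0 <-]]]; exists (a *: x), (a * s); split.
    + by case: (dual_cone_ccone K) => _ _ _; apply.
    + exact: mulr_ge0.
    + by rewrite scale_col_mx scalemxAr dotZr -mulrDr scale_scalar_mx.
have Gdot x s z r : dot (col_mx (B *m x) (dot f x + s)%:M) (col_mx z r%:M) =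
    dot (r *: f + B^T *m z) x + r * s.
  by rewrite dot_col_mx dot_scalar dot_mull dotDl dotZl (dotC x); ring.
suff [x [s [Kx s0 /eq_col_mx[Bx /matrixP/(_ 0 0)]]]] :
    G (col_mx b (dot b y)%:M).
  rewrite !mxE eqxx !mulr1n => Es; exists x; split=> //.
  have := weak_duality Kx Bx Ky; lra.
(* A separating vector [(y', r)] has [r >= 0]. If [r > 0], then [- y' / r] is dual feasible with a
   value above the maximum; if [r = 0], then [y - y'] is. *)
apply: contrapT => /(separation cG)[z [Gz]].
rewrite -(vsubmxK z) in Gz *; move: (usubmx z) (dsubmx z) Gz => y' r'.
rewrite [r']mx11_scalar; move: (r' 0 0) => {r'}r Gz.
rewrite dot_col_mx dot_scalar => neg.
have {}Gz x s : dual_cone K x -> 0 <= s ->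
    0 <= dot (r *: f + B^T *m y') x + r * s.
  by move=> Kx s0; rewrite -Gdot; apply: Gz; exists x, s.
have r0 : 0 <= r.
  have := Gz 0 1; rewrite dot0r add0r mulr1; apply=> //.
  by case: (dual_cone_ccone K).
have Kc : K (r *: f + B^T *m y').
  rewrite -(bipolar cK) => x Kx; rewrite dotC.
  by have := Gz x 0 Kx; rewrite mulr0 addr0; apply.
have [r1|r1] := ltP 0 r.
  have := ymax (- r^-1 *: y').
  have -> : f - B^T *m (- r^-1 *: y') = r^-1 *: (r *: f + B^T *m y').
    rewrite scalerDr scalerA mulVf ?gt_eqF // scale1r -scalemxAr.
    by rewrite scaleNr opprK.
  move=> /(_ (KZ _ _ _ Kc)); rewrite invr_ge0 => /(_ r0).
  rewrite dotZr mulNr mulrC -mulNr ler_pdivrMr // => h.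
  have : dot b y * r = r * dot b y by rewrite mulrC.
  lra.
have rE : r = 0 by apply/eqP; rewrite eq_le r1 r0.
move: Kc neg; rewrite rE scale0r add0r mulr0 addr0 => Kc neg.
have := ymax (y - y'); rewrite mulmxBr opprB addrCA addrC.
move=> /(_ (KD _ _ Ky Kc)); rewrite dotBr; lra.
Qed.

End Duality.

(** * Relative interiors of convex cones *)

Section RelativeInterior.
Context {R : realType} {n : nat}.
Implicit Types C F : set 'cV[R]_n.

Lemma riP C x : ri C x <-> C x /\ exists2 d, 0 < d &
  forall y, `|x - y| < d -> affine_hull C y -> C y.
Proof.
split=> -[Cx].
  move=> /nbhs_ballP[d /= d0 H]; split=> //; exists d => // y xy.
  by apply: H; rewrite mx_norm_ball.
move=> [d d0 H]; split=> //; apply/nbhs_ballP; exists d => // y.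
by rewrite mx_norm_ball; exact: H.
Qed.

Lemma affine_hull_affine C : affine_set (affine_hull C).
Proof.
move=> x y t Hx Hy M MC; have [affM CM] := MC.
by apply: affM; [exact: (Hx M MC)|exact: (Hy M MC)].
Qed.

Lemma affine_set_subspace (S : set 'cV[R]_n) :
  S 0 -> affine_set S -> lin_subspace S.
Proof.
move=> S0 affS.
have SZ a x : S x -> S (a *: x).
  by move=> Sx; have := affS _ _ a Sx S0; rewrite scaler0 addr0.
split=> // a x y Sx Sy.
have -> : a *: x + y = 2 *: (2^-1 *: (a *: x) + (1 - 2^-1) *: y).
  have -> : 1 - 2^-1 = 2^-1 :> R by field.
  by rewrite -scalerDr scalerA divff ?scale1r.
by apply: (SZ); apply: affS => //; apply: SZ.
Qed.

(** The segment from [y] to [e] can be prolonged slightly beyond [e] inside [C]; a positive [<y, x>]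
    would make the form negative there. *)
Lemma ri_orthogonal C e x : ri C e -> dual_cone C x -> dot e x = 0 ->
  forall y, C y -> dot y x = 0.
Proof.
move=> /riP[Ce [d d0 Hd]] Cx ex y Cy.
apply/eqP; rewrite eq_le Cx // andbT.
have [->|ye] := eqVneq y e; first by rewrite ex.
have ne : 0 < `|y - e| by rewrite normr_gt0 subr_eq0.
pose t := d / 2 / `|y - e|.
have t0 : 0 < t by rewrite !divr_gt0.
have : C (e - t *: (y - e)).
  apply: Hd.
    rewrite opprB addrC subrK normrZ gtr0_norm // /t divfK ?gt_eqF //; lra.
  have -> : e - t *: (y - e) = (1 + t) *: e + (1 - (1 + t)) *: y.
    apply/colP => i; rewrite !mxE; ring.
  by apply: affine_hull_affine; exact: sub_gen_smallest.
move=> /Cx; rewrite dotBl dotZl dotBl ex sub0r subr0 oppr_ge0.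
by rewrite pmulr_rle0.
Qed.

(** If [z] is close to [f + a e] in the affine hull, which is a linear subspace, then [(z - f) / a]
    is close to [e] in it, hence in [C]. *)
Lemma ri_addr C f e a : ccone C -> C f -> ri C e -> 0 < a -> ri C (f + a *: e).
Proof.
move=> [cC C0 CD CZ] Cf /riP[Ce [d d0 Hd]] a0; apply/riP; split.
  by apply: CD => //; apply: CZ => //; exact: ltW.
exists (a * d); first exact: mulr_gt0.
move=> z zd Hz.
have sub : lin_subspace (affine_hull C).
  apply: affine_set_subspace; first exact: sub_gen_smallest.
  exact: affine_hull_affine.
have [h0 hl] := sub.
have -> : z = f + a *: (a^-1 *: (z - f)).
  by rewrite scalerA divff ?gt_eqF // scale1r addrC subrK.
apply: CD => //; apply: CZ; first exact: ltW.
apply: Hd.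
  have -> : e - a^-1 *: (z - f) = a^-1 *: (f + a *: e - z).
    apply/colP => i; rewrite !mxE; field; exact: lt0r_neq0.
  by rewrite normrZ gtr0_norm ?invr_gt0 // ltr_pdivrMl.
rewrite -[_ *: _]addr0; apply: (hl) => //.
rewrite addrC -scaleN1r; apply: hl => //.
exact: sub_gen_smallest.
Qed.

(** For a convex cone this is its linear span. *)
Definition span_cone C : set 'cV[R]_n :=
  [set x | exists u v, [/\ C u, C v & x = u - v]].

Lemma span_cone_subspace C : C 0 -> (forall x y, C x -> C y -> C (x + y)) ->
  (forall (a : R) x, 0 <= a -> C x -> C (a *: x)) -> lin_subspace (span_cone C).
Proof.
move=> C0 CD CZ; split; first by exists 0, 0; rewrite subr0.
move=> a _ _ [u [v [Cu Cv ->]]] [u' [v' [Cu' Cv' ->]]].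
have [a0|a0] := leP 0 a.
  exists (a *: u + u'), (a *: v + v'); split; try by apply: CD => //; apply: CZ.
  by rewrite scalerBr opprD addrACA.
have a1 : 0 <= - a by lra.
exists (- a *: v + u'), (- a *: u + v').
split; try by apply: CD => //; apply: CZ.
apply/colP => i; rewrite !mxE; ring.
Qed.

Lemma ccone_sum C I (s : seq I) (F : I -> 'cV[R]_n) : ccone C ->
  (forall i, C (F i)) -> C (\sum_(i <- s) F i).
Proof. by move=> [_ C0 CD _] CF; apply: big_ind. Qed.

(* If the projections of the basis vectors onto the span of [C] are
   [u_i - v_i], then [\sum_i (u_i + v_i)] is in the relative interior, with
   radius 1 in the sup norm. *)
Lemma ri_nonempty C : ccone C -> exists e, ri C e.
Proof.
move=> cC; have [clC C0 CD CZ] := cC.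
have sub := span_cone_subspace C0 CD CZ.
have [P [SP PS]] := subspace_proj sub.
have /choice[uv Huv] : forall i, exists p : 'cV[R]_n * 'cV[R]_n,
    [/\ C p.1, C p.2 & P *m delta_mx i 0 = p.1 - p.2].
  by move=> i; have [u [v [Cu Cv E]]] := SP (delta_mx i 0); exists (u, v).
pose e := \sum_i ((uv i).1 + (uv i).2).
have Ce : C e by apply: ccone_sum => // i; have [? ? _] := Huv i; apply: CD.
have hullS : affine_hull C `<=` span_cone C.
  apply: smallest_sub => [x y t Sx Sy|x Cx]; last by exists x, 0; rewrite subr0.
  have [S0 Sl] := sub; apply: (Sl) => //.
  by rewrite -[_ *: _]addr0; apply: Sl.
exists e; apply/riP; split=> //; exists 1 => // z ez /hullS Sz.
have : span_cone C (z - e).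
  rewrite addrC -scaleN1r; case: sub => _ Sl; apply: Sl => //.
  by exists e, 0; rewrite subr0.
move=> /PS Pze.
have -> : z = \sum_i ((1 + (z - e) i 0) *: (uv i).1 +
                      (1 - (z - e) i 0) *: (uv i).2).
  transitivity (e + \sum_i (z - e) i 0 *: ((uv i).1 - (uv i).2)).
    rewrite -[LHS](subrK e) addrC; congr (_ + _).
    rewrite -[LHS]Pze {1}[z - e]matrix_sum_delta mulmx_sumr.
    apply: eq_bigr => i _.
    by rewrite big_ord1 -scalemxAr; have [_ _ ->] := Huv i.
  rewrite -big_split /=; apply: eq_bigr => i _; move: ((z - e) i 0) => d.
  apply/colP => k; rewrite !mxE; ring.
apply: ccone_sum => // i; have [? ? _] := Huv i.
have := le_lt_trans (coord_le_norm (e - z) i 0) ez.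
have -> : (z - e) i 0 = - (e - z) i 0 by rewrite !mxE opprB.
rewrite ltr_norml => /andP[h1 h2].
by apply: CD; apply: CZ => //; lra.
Qed.

End RelativeInterior.

(** * Faces of cones and the distance to polyhedrality *)

Section Faces.
Context {R : realType} {n : nat}.
Implicit Types C F G : set 'cV[R]_n.

Lemma face_trans C F G : face C F -> face F G -> face C G.
Proof.
move=> [FC _ CF] [GF cvG FG]; split=> // [x /GF/FC //|x y t Cx Cy t01 Gxy].
have [Fx Fy] := CF x y t Cx Cy t01 (GF _ Gxy); exact: FG Gxy.
Qed.

Lemma face_refl C : ccone C -> face C C.
Proof.
by move=> /closed_convex_coneP[_ _ cvC _]; split.
Qed.

(** A point [f] of the face is the midpoint of 0 and [2 f], so 0 is in the face; for [a > 1], [x]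
    lies between [a x] and 0, so [a x] is too. Smaller multiples come from convexity. *)
Lemma face_cone C F : ccone C -> face C F -> F !=set0 ->
  [/\ F 0, forall x y, F x -> F y -> F (x + y) &
      forall (a : R) x, 0 <= a -> F x -> F (a *: x)].
Proof.
move=> [cC C0 CD CZ] [FC /convex_setP cvF CF] [f Ff].
have FCZ a x : 0 <= a -> F x -> C (a *: x) by move=> a0 /FC; apply: CZ.
have F0 : F 0.
  have h : (0 : R) < (2^-1 : R) < 1 by apply/andP; split; lra.
  have := CF 0 (2 *: f) 2^-1 C0 (FCZ _ _ _ Ff) h.
  have -> : 2^-1 *: 0 + (1 - 2^-1) *: (2 *: f) = f.
    apply/colP => i; rewrite !mxE; by field.
  by move=> /(_ (ler0n R 2) Ff)[].
have FZ a x : 0 <= a -> F x -> F (a *: x).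
  move=> a0 Fx; have [a1|a1] := ltP 1 a.
    have h : 0 < a^-1 < 1 by rewrite invr_gt0 invf_lt1; lra.
    have := CF (a *: x) 0 a^-1 (FCZ _ _ a0 Fx) C0 h.
    have a' : a != 0 by rewrite gt_eqF //; lra.
    by rewrite scaler0 addr0 scalerA mulVf // scale1r => /(_ Fx)[].
  have [->|a0'] := eqVneq a 0; first by rewrite scale0r.
  have [->|a1'] := eqVneq a 1; first by rewrite scale1r.
  have h : 0 < a < 1 by rewrite lt_def a0' a0 lt_def eq_sym a1' a1.
  by have := cvF x 0 a h Fx F0; rewrite scaler0 addr0.
split=> // x y Fx Fy.
have -> : x + y = 2 *: (2^-1 *: x + (1 - 2^-1) *: y).
  apply/colP => i; rewrite !mxE; by field.
by apply: FZ => //; apply: cvF => //; apply/andP; split; lra.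
Qed.

(** If [x = u - v], the midpoint of [x] and [v] is [u / 2], which lies in the face. A nonempty face
    is thus determined by its span. *)
Lemma face_span C F x : ccone C -> face C F -> F !=set0 ->
  C x -> span_cone F x -> F x.
Proof.
move=> cC fF F0 Cx [u [v [Fu Fv xE]]].
have [_ FD FZ] := face_cone cC fF F0; have [FC _ CF] := fF.
have h : (0 : R) < (2^-1 : R) < 1 by apply/andP; split; lra.
have [|//] := CF x v 2^-1 Cx (FC _ Fv) h.
have -> : 2^-1 *: x + (1 - 2^-1) *: v = 2^-1 *: u.
  rewrite xE; apply/colP => i; rewrite !mxE; by field.
by apply: FZ => //; lra.
Qed.

(** The spans of the faces in a chain increase strictly by [face_span], so the span of the face of
    index [i] has dimension at least [i]. *)
Lemma poly_chain_length C (D : nat -> set 'cV[R]_n) l :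
  ccone C -> poly_chain C D l -> (l <= n.+1)%N.
Proof.
move=> cC [l0 fD lt _ _].
have /choice[B BE] : forall i, exists B : 'M[R]_n,
    (i < l)%N -> forall x, span_cone (D i) x <-> (x^T <= B)%MS.
  move=> i; have [il|il] := boolP (i < l)%N; last by exists 0.
  have [fi Di0] := fD i il; have [F0 FD FZ] := face_cone cC fi Di0.
  by have [B HB] := subspace_mx (span_cone_subspace F0 FD FZ); exists B.
have rk i : (i < l)%N -> (i <= \rank (B i))%N.
  elim: i => // i IH il; have il' := ltnW il.
  apply: leq_ltn_trans (IH il') _.
  have [sD nD] := lt i il.
  have sB : (B i <= B i.+1)%MS.
    apply/rV_subP => v; rewrite -(trmxK v) => /(BE i il')[x [y [Dx Dy E]]].
    by apply/(BE i.+1 il); exists x, y; split=> //; apply: sD.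
  rewrite ltn_neqAle mxrankS // andbT; apply/negP => /eqP rE.
  apply: nD => x Dx.
  have [fi Di0] := fD i il'.
  have [[DC _ _] _] := fD _ il.
  apply: (face_span cC fi Di0 (DC _ Dx)).
  have /eqmxP eB : (B i == B i.+1)%MS.
    by rewrite -(mxrank_leqif_eq sB) rE.
  apply/(BE i il'); rewrite eB; apply/(BE i.+1 il).
  have [F0 _ _] := face_cone cC (fD _ il).1 (fD _ il).2.
  by exists x, 0; split; rewrite ?subr0.
case: l l0 fD lt BE rk => // l _ _ _ _ rk.
by rewrite ltnS (leq_trans (rk l (ltnSn l))) // rank_leq_row.
Qed.

(** Provides a chain of length 1, so that the maximum defining [dist_poly] exists. *)
Lemma lineality_face C : ccone C ->
  [/\ face C (C `&` [set x | C (- x)]), C `&` [set x | C (- x)] !=set0 &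
      polyhedral (C `&` [set x | C (- x)])].
Proof.
move=> [cC C0 CD CZ].
have CZ' (a : R) x : 0 < a -> C (a *: x) -> C x.
  move=> a0 /(CZ a^-1); rewrite scalerA mulVf ?gt_eqF // scale1r.
  by apply; rewrite invr_ge0 ltW.
have sub : lin_subspace (C `&` [set x | C (- x)]).
  split; first by split; rewrite /= ?oppr0.
  move=> a x y [Cx /= Cx'] [Cy /= Cy'].
  have [a0|a0] := leP 0 a.
    split; first by apply: CD => //; apply: CZ.
    by rewrite /= opprD -scalerN; apply: CD => //; apply: CZ.
  have a1 : 0 <= - a by lra.
  split.
    by rewrite -(opprK a) scaleNr -scalerN; apply: CD => //; apply: CZ.
  by rewrite /= opprD -scaleNr; apply: CD => //; apply: CZ.
split.
- split=> [x []//||x y t Cx Cy /andP[t0 t1] [_ /= Cxy]].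
    apply/convex_setP => x y t _ Cx Cy; case: sub => S0 Sl; apply: (Sl) => //.
    by rewrite -[_ *: _]addr0; apply: Sl.
  have t1' : 0 < 1 - t by lra.
  split; split=> //=.
    apply: (CZ' t) => //.
    have -> : t *: - x = - (t *: x + (1 - t) *: y) + (1 - t) *: y.
      by rewrite opprD subrK scalerN.
    by apply: CD => //; apply: CZ => //; exact: ltW.
  apply: (CZ' (1 - t)) => //.
  have -> : (1 - t) *: - y = - (t *: x + (1 - t) *: y) + t *: x.
    by rewrite opprD addrAC addNr add0r scalerN.
  by apply: CD => //; apply: CZ => //; exact: ltW.
- by exists 0; split; rewrite /= ?oppr0.
have [P [SP PS]] := subspace_proj sub.
(* With [P] a projection onto the lineality space, the inequalities [x - P x <= 0] and
   [P x - x <= 0] say that [P x = x]. *)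
exists (n + n)%N, (col_mx (1%:M - P) (P - 1%:M)), 0.
apply/seteqP; split=> [x /PS Px i|x /= H].
  by rewrite mul_col_mx !mulmxBl mul1mx Px subrr col_mx0 !mxE.
have <- : P *m x = x; last exact: SP.
apply/colP => i; apply/eqP; rewrite eq_le.
have := H (lshift n i); have := H (rshift n i).
rewrite mul_col_mx col_mxEu col_mxEd !mulmxBl mul1mx !mxE.
by rewrite !subr_le0 => -> ->.
Qed.

(** Chains exist and have bounded length, so [xget] finds a genuine maximum rather than its
    default. *)
Lemma dist_polyP C : ccone C ->
  (exists D, poly_chain C D (dist_poly C).+1) /\
  forall D k, poly_chain C D k -> (k <= (dist_poly C).+1)%N.
Proof.
move=> cC.
pose good l := `[< exists D, poly_chain C D l.+1 >].
have ex0 : exists l, good l.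
  have [fL L0 pL] := lineality_face cC.
  exists 0%N; apply/asboolP; exists (fun=> C `&` [set x | C (- x)]).
  by split=> // -[].
have ub l : good l -> (l <= n)%N.
  by move=> /asboolP[D cD]; rewrite -ltnS (poly_chain_length cC cD).
have [l /asboolP[D cD] lmax] := ex_maxnP ex0 ub.
pose P := [set l | (exists D, poly_chain C D l.+1) /\
                   forall D k, poly_chain C D k -> (k <= l.+1)%N].
suff : P (dist_poly C) by [].
apply: xgetPex.
exists l; split=> /=; first by exists D.
move=> D' [|k] cD'; first by case: cD'.
by rewrite ltnS; apply: lmax; apply/asboolP; exists D'.
Qed.

Lemma dist_poly_face C F : ccone C -> ccone F -> face C F ->
  (dist_poly F <= dist_poly C)%N.
Proof.
move=> cC cF fF; have [[D [l0 fD lt pD npD]] _] := dist_polyP cF.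
have [_ /(_ D (dist_poly F).+1)] := dist_polyP cC.
rewrite ltnS; apply; split=> // i il; have [fi Di0] := fD i il.
by split=> //; exact: face_trans fi.
Qed.

(** A longest chain of [F] consists of faces of [C], and the nonpolyhedral [C] can be put on top of
    it. *)
Lemma dist_poly_proper_face C F : ccone C -> ccone F -> face C F ->
  F != C -> ~ polyhedral C -> (dist_poly F < dist_poly C)%N.
Proof.
move=> cC cF fF FC npC; have [[D [l0 fD lt pD npD]] _] := dist_polyP cF.
have [_] := dist_polyP cC; set l := (dist_poly F).+1 in l0 fD lt pD npD *.
move=> /(_ (fun i => if (i < l)%N then D i else C) l.+1); rewrite ltnS; apply.
split=> // i.
- move=> _; case: ifP => il.
    by have [fi Di0] := fD i il; split=> //; exact: face_trans fi.
  by split; [exact: face_refl | exists 0; case: cC].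
- rewrite ltnS => il; rewrite il.
  case: ifP => il1; first exact: lt.
  have [[DF _ _] _] := fD i il; have [FC' _ _] := fF.
  split=> [x /DF/FC' //|CD]; case/eqP: FC; apply/seteqP; split=> // x Cx.
  by apply: DF; apply: CD.
- rewrite ltnS => /andP[i0 il]; case: ifP => // il1; apply: npD.
  by rewrite i0.
Qed.

Lemma face_orthogonal C d : ccone C -> dual_cone C d ->
  face C (C `&` orthogonal_to d) /\ ccone (C `&` orthogonal_to d).
Proof.
move=> [cC C0 CD CZ] Cd; have orthE x : orthogonal_to d x = (dot d x = 0) by [].
have cone : ccone (C `&` orthogonal_to d).
  split.
  - apply: closedI => //.
    have -> : orthogonal_to d = [set x | [set z : 'cV[R]_1 | z = 0] (d^T *m x)].
      apply/seteqP; split=> x /=; rewrite orthE dotE.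
        by move=> E; rewrite [d^T *m x]mx11_scalar E raddf0.
      by move=> ->; rewrite mxE.
    by apply: closed_mulmx_preimage; exact: closed_set0E.
  - by split; rewrite ?orthE ?dot0r.
  - move=> x y [Cx dx] [Cy dy]; split; first exact: CD.
    by rewrite orthE dotDr dx dy addr0.
  - move=> a x a0 [Cx dx]; split; first exact: CZ.
    by rewrite orthE dotZr dx mulr0.
split=> //; split=> [x []//||x y t Cx Cy /andP[t0 t1] [_ dxy]].
  by have /closed_convex_coneP[] := cone.
have [dx dy] : dot d x = 0 /\ dot d y = 0.
  have := Cd x Cx; have := Cd y Cy; rewrite !(dotC _ d).
  move: dxy; rewrite orthE dotDr !dotZr => E hy hx.
  have t1' : 0 < 1 - t by lra.
  have p1 : 0 <= t * dot d x by rewrite mulr_ge0 // ltW.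
  have p2 : 0 <= (1 - t) * dot d y by rewrite mulr_ge0 // ltW.
  have e1 : t * dot d x = 0 by lra.
  have e2 : (1 - t) * dot d y = 0 by lra.
  split; apply/eqP.
    by move/eqP: e1; rewrite mulf_eq0 (gt_eqF t0).
  by move/eqP: e2; rewrite mulf_eq0 (gt_eqF t1').
by split; split.
Qed.

End Faces.

(** * Solvability of the pair of problems of Step 2 *)

Section Pair.
Context {R : realType} {r m : nat} {n_ : 'I_r -> nat}.
Local Notation N := (\sum_j n_ j)%N.
Variables (A : 'M[R]_(m, N)) (c : 'cV[R]_N).
Variables (C : set 'cV[R]_N) (e es : 'cV[R]_N).

(** With [u = (x, t, w)] and [z = (y1, y2, y3)], the two problems take the standard form: minimize
    [<f, u>] subject to [B u = b] and [u] in the dual of [K]; maximize [<b, z>] subject to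
    [f - B^T z] in [K]. *)
Let primal x (t w : R) : 'cV[R]_(N + (1 + 1)) := col_mx x (col_mx t%:M w%:M).

Let dual (y1 y2 : R) (y3 : 'cV[R]_m) : 'cV[R]_(1 + (1 + m)) :=
  col_mx y1%:M (col_mx y2%:M y3).

(** The product of [Q] with two half-lines. It is used both for [C] and for the part of the dual of
    [C] that is not finitely generated. *)
Let orthants (Q : set 'cV[R]_N) : set 'cV[R]_(N + (1 + 1)) := [set u |
  [/\ Q (usubmx u), 0 <= usubmx (dsubmx u) 0 0 & 0 <= dsubmx (dsubmx u) 0 0]].

Let K := orthants C.

Let B : 'M[R]_(1 + (1 + m), N + (1 + 1)) :=
  col_mx (row_mx (- c^T) (row_mx (dot c es + 1)%:M (-1)%:M))
    (col_mx (row_mx e^T (row_mx 0 1%:M)) (row_mx A (row_mx (- (A *m es)) 0))).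

Let f := primal 0 1 0.
Let b := dual 0 1 0.

Let scalar_entry (a : R) : (a%:M : 'M_1) 0 0 = a.
Proof. by rewrite mxE eqxx mulr1n. Qed.

Let scalarE (z : 'M[R]_1) : z = (z 0 0)%:M.
Proof. exact: mx11_scalar. Qed.

Let primalE z : exists x t w, z = primal x t w.
Proof.
exists (usubmx z), (usubmx (dsubmx z) 0 0), (dsubmx (dsubmx z) 0 0).
by rewrite /primal -!scalarE !vsubmxK.
Qed.

Let dualE z : exists y1 y2 y3, z = dual y1 y2 y3.
Proof.
exists (usubmx z 0 0), (usubmx (dsubmx z) 0 0), (dsubmx (dsubmx z)).
by rewrite /dual -!scalarE !vsubmxK.
Qed.

Let orthantsE Q x t w : orthants Q (primal x t w) <-> [/\ Q x, 0 <= t & 0 <= w].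
Proof. by rewrite /orthants /primal /= !(col_mxKu, col_mxKd) !scalar_entry. Qed.

Let dot_primal x t w x' t' w' :
  dot (primal x t w) (primal x' t' w') = dot x x' + (t * t' + w * w').
Proof. by rewrite !dot_col_mx !dot_scalar. Qed.

Let dot_f x t w : dot f (primal x t w) = t.
Proof. by rewrite dot_primal dot0l; ring. Qed.

Let dot_b y1 y2 y3 : dot b (dual y1 y2 y3) = y2.
Proof. by rewrite !dot_col_mx !dot_scalar dot0l; ring. Qed.

Let B_primal x t w : B *m primal x t w =
  dual (- dot c (x - t *: es) + t - w) (dot e x + w) (A *m x - t *: (A *m es)).
Proof.
rewrite /B /primal /dual !mul_col_mx !mul_row_col.
rewrite !mul_scalar_mx !mul0mx add0r.
congr col_mx; last congr col_mx.
- rewrite [- c^T *m x]scalarE mulNmx mxE -dotE !scale_scalar_mx -!rmorphD /=.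
  by congr _%:M; rewrite dotBr dotZr; ring.
- by rewrite [e^T *m x]scalarE -dotE scale_scalar_mx -rmorphD /= mul1r.
by rewrite addr0 mul_mx_scalar scalerN.
Qed.

Let BT_dual y1 y2 y3 : B^T *m dual y1 y2 y3 =
  primal (- (y1 *: c) + y2 *: e + A^T *m y3)
    (y1 * (1 + dot c es) - dot es (A^T *m y3)) (y2 - y1).
Proof.
rewrite /B /primal /dual !(tr_col_mx, tr_row_mx) !mul_row_col !mul_col_mx.
rewrite !trmxK !tr_scalar_mx !trmx0 ![(- _)^T]linearN /= !trmxK.
rewrite !mul_mx_scalar !mul0mx !mulNmx !add_col_mx.
congr col_mx; last congr col_mx.
- by rewrite addrA scalerN.
- rewrite [(A *m es)^T *m y3]scalarE -dotE dot_mull scale_scalar_mx scaler0.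
  by rewrite add0r -rmorphB /=; congr _%:M; ring.
by rewrite !scale_scalar_mx addr0 -rmorphD /=; congr _%:M; ring.
Qed.

Let dual_K x t w : ccone C ->
  dual_cone K (primal x t w) <-> [/\ dual_cone C x, 0 <= t & 0 <= w].
Proof.
move=> [cC C0 CD CZ]; split=> [H|[Cx t0 w0] u].
  split.
  - move=> y Cy; have := H (primal y 0 0); rewrite dot_primal !mul0r !addr0.
    by apply; apply/orthantsE.
  - have := H (primal 0 1 0); rewrite dot_primal dot0l mul1r mul0r add0r addr0.
    by apply; apply/orthantsE.
  - have := H (primal 0 0 1); rewrite dot_primal dot0l mul1r mul0r !add0r.
    by apply; apply/orthantsE.
have [x' [t' [w' ->]]] := primalE u.
move=> /orthantsE[Cx' t0' w0']; rewrite dot_primal addr_ge0 ?Cx //.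
by rewrite addr_ge0 // mulr_ge0.
Qed.

Let primal_add x t w x' t' w' :
  primal x t w + primal x' t' w' = primal (x + x') (t + t') (w + w').
Proof. by rewrite !add_col_mx -!rmorphD. Qed.

Let primal_scale a x t w : a *: primal x t w = primal (a *: x) (a * t) (a * w).
Proof. by rewrite !scale_col_mx !scale_scalar_mx. Qed.

Let ccone_orthants Q : ccone Q -> ccone (orthants Q).
Proof.
move=> [cQ Q0 QD QZ].
have ge0 i : closed [set x : 'cV[R]_(N + (1 + 1)) | 0 <= x i 0].
  by apply: (closed_coord (D := [set a | 0 <= a])); exact: closed_ge.
split.
- have -> : orthants Q = [set u | Q (row_mx 1%:M 0 *m u)] `&`
        ([set u | 0 <= u (rshift N (lshift 1 0)) 0] `&`
         [set u | 0 <= u (rshift N (rshift 1 0)) 0]).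
    have uE (u : 'cV[R]_(N + (1 + 1))) : row_mx 1%:M 0 *m u = usubmx u.
      by rewrite -{1}(vsubmxK u) mul_row_col mul1mx mul0mx addr0.
    apply/seteqP; split=> u; rewrite /orthants /setI /= uE !mxE.
      by move=> [? ? ?].
    by move=> [? []].
  apply: closedI; first exact: closed_mulmx_preimage.
  by apply: closedI; exact: ge0.
- by rewrite /orthants /= !linear0 !mxE.
- move=> u v; rewrite /orthants /= !linearD /= !mxE => -[? ? ?] [? ? ?].
  by split; [exact: QD | exact: addr_ge0 | exact: addr_ge0].
- move=> a u a0; rewrite /orthants /= !linearZ /= !mxE => -[? ? ?].
  by split; [exact: QZ | exact: mulr_ge0 | exact: mulr_ge0].
Qed.

Let PC_feasibleE x t w : ccone C ->
  PC_feasible A c C e es (x, t, w) <->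
  dual_cone K (primal x t w) /\ B *m primal x t w = b.
Proof.
move=> cC; rewrite B_primal /PC_feasible; split=> [[Hc [-> -> ->]]|[]].
  by split; [exact/dual_K|].
move=> /(dual_K _ _ _ cC) Hc /eq_col_mx[E1 /eq_col_mx[E2 E3]]; split=> //.
split=> //; first by have /matrixP/(_ 0 0) := E1; rewrite !scalar_entry.
by have /matrixP/(_ 0 0) := E2; rewrite !scalar_entry.
Qed.

Let DC_feasibleE y1 y2 y3 :
  DC_feasible A c C e es (y1, y2, y3) <-> K (f - B^T *m dual y1 y2 y3).
Proof.
rewrite BT_dual -scaleN1r primal_scale primal_add /K orthantsE /DC_feasible.
have -> : 0 + -1 *: (- (y1 *: c) + y2 *: e + A^T *m y3) =
    y1 *: c - y2 *: e - A^T *m y3.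
  by rewrite add0r scaleN1r !opprD opprK.
have -> : 1 + -1 * (y1 * (1 + dot c es) - dot es (A^T *m y3)) =
    1 - y1 * (1 + dot c es) + dot es (A^T *m y3) by ring.
by have -> : 0 + -1 * (y2 - y1) = y1 - y2 by ring.
Qed.

Lemma PC_DC_optimal k (Q : set 'cV[R]_N) (H : 'M[R]_(N, k)) :
  ccone C -> ri (dual_cone C) es -> C e -> ccone Q ->
  (forall x, dual_cone C x <-> exists x' (l : 'cV[R]_k),
     [/\ Q x', forall i, 0 <= l i 0 & x' + H *m l = x]) ->
  (forall x' (l : 'cV[R]_k), Q x' -> (forall i, 0 <= l i 0) ->
     dot e (x' + H *m l) = 0 -> Q (- x')) ->
  exists p d, [/\ PC_optimal A c C e es p, DC_optimal A c C e es d &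
                  p.1.2 = d.1.2].
Proof.
move=> cC ries Ce cQ CQ Qrec; have [clC C0 CD CZ] := cC.
have cK : ccone K := ccone_orthants cC.
have Ces : dual_cone C es by case/riP: ries.
have ees : 0 <= dot e es by exact: Ces.
pose t0 := (1 + dot e es)^-1.
have t0E : t0 * (1 + dot e es) = 1 by rewrite mulVf // gt_eqF //; lra.
have t0p : 0 < t0 by rewrite invr_gt0; lra.
have Pfeas : exists x, dual_cone K x /\ B *m x = b.
  exists (primal (t0 *: es) t0 t0); apply/PC_feasibleE => //.
  split; first split; rewrite ?ltW //.
    by case: (dual_cone_ccone C) => _ _ _; apply=> //; exact: ltW.
  split; first by rewrite subrr dot0r; ring.
    by rewrite dotZr -t0E; ring.
  by rewrite -scalemxAr subrr.
have Dfeas : exists y, K (f - B^T *m y).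
  (* This point has slack [(e, 1, 1)], which lies in [K] because [e] is in [C]. *)
  exists (dual 0 (-1) 0); apply/DC_feasibleE; split.
  - by rewrite scale0r mulmx0 subr0 sub0r scaleNr scale1r opprK.
  - by rewrite mulmx0 dot0r mul0r subr0 addr0.
  - by rewrite sub0r opprK.
have [|z Kz zmax] := dual_attained cK _ Pfeas Dfeas.
  move=> y; have [y1 [y2 [y3 ->]]] := dualE y; rewrite BT_dual dot_b.
  rewrite -{1}scaleN1r primal_scale.
  move=> /orthantsE[Cq]; set q := -1 *: _ in Cq *; rewrite !mulN1r => q2 q3 y2p.
  (* Pairing a recession direction with [(es, 1, 1)] gives [- y2 (1 + <e, es>) <= 0], a sum of three
     nonnegative terms, so each vanishes. As [es] is a relative interior point, [q] is then
     orthogonal to the whole dual cone and [- q] is in [C]. *)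
  have : dot q es + - (y1 * (1 + dot c es) - dot es (A^T *m y3)) + - (y2 - y1)
      = - (y2 * (1 + dot e es)).
    by rewrite /q !(dotZl, dotDl, dotNl) (dotC es); ring.
  have := Ces q Cq.
  have p2 : 0 <= y2 * (1 + dot e es) by rewrite mulr_ge0 //; lra.
  move=> p1 E.
  have qes : dot q es = 0 by lra.
  have E2 : y1 * (1 + dot c es) - dot es (A^T *m y3) = 0 by lra.
  have E3 : y2 - y1 = 0 by lra.
  apply/orthantsE; rewrite E2 E3; split=> //.
  rewrite -(bipolar cC) => x Cx.
  have -> : - (y1 *: c) + y2 *: e + A^T *m y3 = - q.
    by rewrite /q scaleN1r opprK.
  rewrite dotNr.
  rewrite (ri_orthogonal ries (x := q)) ?oppr0 //; last by rewrite dotC.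
  by rewrite bipolar.
pose H' : 'M[R]_(N + (1 + 1), k) := col_mx H 0.
have H'E x t w l : primal x t w + H' *m l = primal (x + H *m l) t w.
  by rewrite mul_col_mx mul0mx add_col_mx addr0.
have [||u [Ku Bu fu]] := @primal_attained _ _ _ k K (orthants Q) H' B f b z cK
  (ccone_orthants cQ) _ _ Kz zmax.
- move=> u; have [x [t [w ->]]] := primalE u.
  rewrite dual_K //; split=> [[/CQ[x' [l [Qx' l0 E]]] t1 w1]|].
    by exists (primal x' t w), l; split=> //; [exact/orthantsE | rewrite H'E E].
  move=> [v [l]]; have [x' [t' [w' ->]]] := primalE v.
  rewrite H'E => -[/orthantsE[Qx' t1 w1] l0 /eq_col_mx[E1 /eq_col_mx[E2 E3]]].
  have /matrixP/(_ 0 0) := E2; rewrite !scalar_entry => <-.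
  have /matrixP/(_ 0 0) := E3; rewrite !scalar_entry => <-.
  by split=> //; apply/CQ; exists x', l.
- move=> u l; have [x [t [w ->]]] := primalE u.
  move=> /orthantsE[Qx t1 w1] l0; rewrite H'E B_primal dot_f => E t2.
  (* Nonpositive cost forces [t = 0]; the second equation, whose right-hand side is now 0, then
     forces [w = 0] and [<e, x + H l> = 0]. *)
  have tE : t = 0 by apply/eqP; rewrite eq_le t1 t2.
  have p2 : dot e (x + H *m l) + w = 0.
    move: E; have -> : 0 = dual 0 0 0 by rewrite /dual !raddf0 !col_mx0.
    move=> /eq_col_mx[_ /eq_col_mx[/matrixP/(_ 0 0)]].
    by rewrite !scalar_entry.
  have : 0 <= dot e (x + H *m l).
    have : dual_cone C (x + H *m l) by apply/CQ; exists x, l.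
    exact.
  move=> p1; have wE : w = 0 by lra.
  have eE : dot e (x + H *m l) = 0 by lra.
  rewrite tE wE -scaleN1r primal_scale mulr0 scaleN1r; apply/orthantsE.
  by split=> //; exact: (Qrec x l).
have [x [t [w uE]]] := primalE u; have [y1 [y2 [y3 zE]]] := dualE z.
rewrite uE dot_f zE dot_b in Ku Bu fu.
rewrite zE in Kz zmax.
exists (x, t, w), (y1, y2, y3); split=> //; split.
- exact/PC_feasibleE.
- move=> [[x' t'] w'] /(PC_feasibleE _ _ _ cC)[Kx' Bx'] /=.
  by have := weak_duality Kx' Bx' Kz; rewrite dot_f dot_b fu.
- exact/DC_feasibleE.
- move=> [[y1' y2'] y3'] /DC_feasibleE Ky' /=.
  by have := zmax _ Ky'; rewrite !dot_b.
Qed.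

End Pair.

(** * Duals of polyhedral cones and their finite generation *)

Section PolyhedralDual.
Context {R : realType}.

(** Farkas: the cone is also given by [M x <= 0], and its dual is generated by the columns of
    [- M^T]. The generated cone is closed by [closed_image_gen] with [Q] reduced to 0, so a dual
    vector outside it could be separated. *)
Lemma polyhedral_dual n (C : set 'cV[R]_n) : ccone C -> polyhedral C ->
  exists k (H : 'M[R]_(n, k)), forall x, dual_cone C x <->
    exists2 l : 'cV[R]_k, (forall i, 0 <= l i 0) & H *m l = x.
Proof.
move=> [cC C0 CD CZ] [k [M [d CE]]].
have CM x : C x <-> forall i, (M *m x) i 0 <= 0.
  split=> [Cx i|H].
    rewrite leNgt; apply/negP => p.
    have d0 : 0 <= d i 0.
      by move: C0; rewrite CE => /= /(_ i); rewrite mulmx0 mxE.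
    (* Scaling [x] by this factor makes row [i] equal to [d_i + 1], violating the constraint. *)
    have t0 : 0 <= (d i 0 + 1) / (M *m x) i 0 by rewrite divr_ge0 ?ltW //; lra.
    have := CZ _ _ t0 Cx; rewrite CE => /(_ i) /=.
    by rewrite -scalemxAr mxE divfK ?gt_eqF //; lra.
  move: C0; rewrite CE /= => d0 i; apply: le_trans (H i) _.
  by have := d0 i; rewrite mulmx0 mxE.
exists k, (- M^T).
pose G : set 'cV[R]_n := [set x |
  exists2 l : 'cV[R]_k, (forall i, 0 <= l i 0) & - M^T *m l = x].
have dotG (l : 'cV[R]_k) y : dot (- M^T *m l) y = - \sum_i l i 0 * (M *m y) i 0.
  by rewrite mulNmx dotNl dot_mull trmxK.
have cG : ccone G.
  split.
  - have -> : G = [set z | exists (x : 'cV[R]_n) (l : 'cV[R]_k),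
        [/\ [set 0] x, forall i, 0 <= l i 0 & 0 *m x + - M^T *m l = z]].
      apply/seteqP; split=> z.
        by move=> [l l0 E]; exists 0, l; split; rewrite // mulmx0 add0r.
      by move=> [x [l [_ l0]]]; rewrite mul0mx add0r; exists l.
    apply: closed_image_gen => [|x l -> _ _]; last by rewrite /= oppr0.
    split=> //; first exact: closed_set0E.
      by move=> x y -> ->; rewrite /= addr0.
    by move=> a x _ ->; rewrite /= scaler0.
  - by exists 0; [move=> i; rewrite mxE | rewrite mulmx0].
  - move=> _ _ [l l0 <-] [l' l0' <-]; exists (l + l'); last by rewrite mulmxDr.
    by move=> i; rewrite mxE addr_ge0.
  - move=> a _ a0 [l l0 <-]; exists (a *: l); last by rewrite scalemxAr.
    by move=> i; rewrite mxE mulr_ge0.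
move=> x; split=> [Cx|[l l0 <-] y /CM My]; last first.
  rewrite dotC dotG oppr_ge0; apply: sumr_le0 => i _.
  by rewrite mulr_ge0_le0.
apply: contrapT => /(separation cG)[y [Gy]]; apply/negP; rewrite -leNgt dotC.
apply: Cx; apply/CM => i; rewrite -oppr_ge0.
have := Gy (- M^T *m delta_mx i 0); rewrite dotG.
rewrite (bigD1 i) //= big1 => [|j ji]; last first.
  by rewrite mxE (negbTE ji) mul0r.
rewrite mxE !eqxx mul1r addr0; apply; exists (delta_mx i 0) => // j.
by rewrite mxE; case: (_ && _).
Qed.

(** A polyhedral cone puts its whole dual in the generators, with [Q] reduced to 0. Otherwise there
    are no generators, and the last condition is [ri_orthogonal] for [e]. *)
Lemma dual_decomposition n (C : set 'cV[R]_n) e : ccone C ->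
  (polyhedral C -> e = 0) -> (~ polyhedral C -> ri C e) ->
  exists k (Q : set 'cV[R]_n) (H : 'M[R]_(n, k)),
  [/\ ccone Q,
      forall x, dual_cone C x <-> exists x' (l : 'cV[R]_k),
        [/\ Q x', forall i, 0 <= l i 0 & x' + H *m l = x] &
      forall x' (l : 'cV[R]_k), Q x' -> (forall i, 0 <= l i 0) ->
        dot e (x' + H *m l) = 0 -> Q (- x')].
Proof.
move=> cC e0 eri; have [pC|npC] := pselect (polyhedral C).
  have [k [H CH]] := polyhedral_dual cC pC.
  exists k, [set 0], H; split=> [|x|x' l -> _ _].
  - split=> //; first exact: closed_set0E.
      by move=> x y -> ->; rewrite /= addr0.
    by move=> a x _ ->; rewrite /= scaler0.
  - rewrite CH; split=> [[l l0 <-]|[x' [l [-> l0 <-]]]].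
      by exists 0, l; rewrite add0r.
    by exists l; rewrite ?add0r.
  by rewrite /= oppr0.
exists 0%N, (dual_cone C), 0; split=> [|x|x' l Cx _].
- exact: dual_cone_ccone.
- split=> [Cx|[x' [l [Cx' _ <-]]]]; last by rewrite mul0mx addr0.
  by exists x, 0; split=> [//|[]//|]; rewrite mul0mx addr0.
rewrite mul0mx addr0 => ex y Cy.
by rewrite dotNr (ri_orthogonal (eri npC) Cx ex Cy) oppr0.
Qed.

End PolyhedralDual.

(** * Products of cones, block by block *)

Section Product.
Context {R : realType} {r : nat} {n_ : 'I_r -> nat}.
Variable C_ : forall j, set 'cV[R]_(n_ j).
Arguments C_ : clear implicits.
Hypothesis C_cone : forall j, ccone (C_ j).
Local Notation N := (\sum_j n_ j)%N.

Lemma submxcolE p (k_ : 'I_p -> nat) (x : 'cV[R]_(\sum_j k_ j)) j :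
  submxcol x j = submxcol 1%:M j *m x.
Proof. by rewrite submxcol_mul mul1mx. Qed.

Lemma submxcolZ (a : R) (x : 'cV[R]_N) j :
  submxcol (a *: x) j = a *: submxcol x j.
Proof. by rewrite !(submxcolE _ j) -scalemxAr. Qed.

Lemma dot_blocks (x y : 'cV[R]_N) :
  dot x y = \sum_j dot (submxcol x j) (submxcol y j).
Proof.
rewrite dotE -{1}(submxcolK x) -{1}(submxcolK y) tr_mxcol mul_mxrow_mxcol.
by rewrite summxE; apply: eq_bigr => j _; rewrite dotE.
Qed.

Lemma block_prod j : block (prod_cone C_) j = C_ j.
Proof.
apply/seteqP; split=> [_ [x Cx <-]|x Cx]; first exact: Cx.
exists (\mxcol_i dfwith (fun i => 0 : 'cV[R]_(n_ i)) x i).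
  move=> i; rewrite mxcolK.
  have [<-|ji] := eqVneq j i; first by rewrite dfwith_in.
  by rewrite dfwith_out //; case: (C_cone i).
by rewrite mxcolK dfwith_in.
Qed.

Lemma prod_ccone : ccone (prod_cone C_).
Proof.
split=> [|j|x y Cx Cy j|a x a0 Cx j].
- apply: closed_forall => j.
  have -> : (fun x => C_ j (submxcol x j)) =
      [set x : 'cV[R]_N | C_ j (submxcol 1%:M j *m x)].
    by apply/seteqP; split=> x /=; rewrite -submxcolE.
  by apply: closed_mulmx_preimage; case: (C_cone j).
- by rewrite submxcol0; case: (C_cone j).
- by rewrite submxcolD; case: (C_cone j) => _ _ D _; exact: D.
- by rewrite submxcolZ; case: (C_cone j) => _ _ _; apply.
Qed.

Lemma dual_prod x : dual_cone (prod_cone C_) x <->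
  forall j, dual_cone (C_ j) (submxcol x j).
Proof.
split=> [H j y|H y Cy]; last first.
  by rewrite dot_blocks; apply: sumr_ge0 => j _; apply: H; exact: Cy.
rewrite -{1}block_prod => -[z Cz zy].
have := H (\mxcol_i dfwith (fun i => 0 : 'cV[R]_(n_ i)) y i).
rewrite dot_blocks (bigD1 j) //= big1 => [|i ij]; last first.
  by rewrite mxcolK dfwith_out 1?eq_sym // dot0l.
rewrite mxcolK dfwith_in addr0; apply=> i; rewrite mxcolK.
have [<-|ji] := eqVneq j i; first by rewrite dfwith_in -zy; exact: Cz.
by rewrite dfwith_out //; case: (C_cone i).
Qed.

Lemma step2_e_prod e : step2_e (prod_cone C_) e <->
  forall j, (polyhedral (C_ j) -> submxcol e j = 0) /\
            (~ polyhedral (C_ j) -> ri (C_ j) (submxcol e j)).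
Proof. by split=> H j; have := H j; rewrite block_prod. Qed.

Lemma step2_e_mem e : step2_e (prod_cone C_) e -> prod_cone C_ e.
Proof.
move=> /step2_e_prod H j; have [p np] := H j.
have [/p ->|/np] := pselect (polyhedral (C_ j)); first by case: (C_cone j).
by case/riP.
Qed.

(** The blockwise decompositions are assembled. In the last condition [<e, x>] is a sum of
    nonnegative block terms, so it vanishes only if each does. *)
Lemma dual_decomposition_prod e : step2_e (prod_cone C_) e ->
  exists k (Q : set 'cV[R]_N) (H : 'M[R]_(N, k)),
  [/\ ccone Q,
      forall x, dual_cone (prod_cone C_) x <-> exists x' (l : 'cV[R]_k),
        [/\ Q x', forall i, 0 <= l i 0 & x' + H *m l = x] &
      forall x' (l : 'cV[R]_k), Q x' -> (forall i, 0 <= l i 0) ->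
        dot e (x' + H *m l) = 0 -> Q (- x')].
Proof.
move=> He; have Ce := step2_e_mem He; move/step2_e_prod: He => He.
pose ok j (s : {k & 'M[R]_(n_ j, k)} * set 'cV[R]_(n_ j)) :=
  [/\ ccone s.2,
      forall x, dual_cone (C_ j) x <-> exists x' (l : 'cV[R]_(tag s.1)),
        [/\ s.2 x', forall i, 0 <= l i 0 & x' + tagged s.1 *m l = x] &
      forall x' (l : 'cV[R]_(tag s.1)), s.2 x' -> (forall i, 0 <= l i 0) ->
        dot (submxcol e j) (x' + tagged s.1 *m l) = 0 -> s.2 (- x')].
have ex j : exists s, ok j s.
  have [p np] := He j.
  have [k [Q [H HQ]]] := dual_decomposition (C_cone j) p np.
  by exists (Tagged _ H, Q).
pose s j := sval (cid (ex j)); have sP j : ok j (s j) := svalP (cid (ex j)).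
pose k_ j := tag (s j).1.
(* Block-diagonal: block row [j] reads off block [j] of the coefficients and applies the generators
   of the [j]-th dual. *)
pose H : 'M[R]_(N, \sum_j k_ j) :=
  \mxcol_j (tagged (s j).1 *m submxcol (1%:M : 'M[R]_(\sum_j k_ j)) j).
have HE l j : submxcol (H *m l) j = tagged (s j).1 *m submxcol l j.
  by rewrite -submxcol_mul [submxcol H j]mxcolK -mulmxA submxcol_mul mul1mx.
have sub_ge0 (l : 'cV[R]_(\sum_j k_ j)) :
    (forall i, 0 <= l i 0) <-> forall j i, 0 <= submxcol l j i 0.
  split=> [l0 j i|l0 i]; first by rewrite mxE.
  rewrite -(submxcolK l) mxE; exact: l0.
exists (\sum_j k_ j)%N, [set x | forall j, (s j).2 (submxcol x j)], H; split.
- split=> [|j|x y Cx Cy j|a x a0 Cx j].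
  + apply: closed_forall => j.
    have -> : (fun x => (s j).2 (submxcol x j)) =
        [set x : 'cV[R]_N | (s j).2 (submxcol 1%:M j *m x)].
      by apply/seteqP; split=> x /=; rewrite -submxcolE.
    by apply: closed_mulmx_preimage; case: (sP j) => -[].
  + by rewrite submxcol0; case: (sP j) => -[].
  + by rewrite submxcolD; case: (sP j) => -[_ _ D _] _ _; exact: D.
  + by rewrite submxcolZ; case: (sP j) => -[_ _ _ Z] _ _; exact: Z.
- move=> x; rewrite dual_prod; split=> [Cx|[x' [l [Qx' /sub_ge0 l0 <-]]] j].
    have ex' j : exists xl : 'cV[R]_(n_ j) * 'cV[R]_(k_ j),
        [/\ (s j).2 xl.1, forall i, 0 <= xl.2 i 0 &
            xl.1 + tagged (s j).1 *m xl.2 = submxcol x j].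
      by have [_ /(_ (submxcol x j))[/(_ (Cx j))[x' [l ?]] _] _] := sP j;
         exists (x', l).
    pose xl j := sval (cid (ex' j)); have xlP j := svalP (cid (ex' j)).
    exists (\mxcol_j (xl j).1), (\mxcol_j (xl j).2); split.
    + by move=> j; rewrite mxcolK; case: (xlP j).
    + by apply/sub_ge0 => j i; rewrite mxcolK; case: (xlP j).
    + apply/mxcolP => j.
      by rewrite submxcolD HE !mxcolK; case: (xlP j).
  have [_ -> _] := sP j; exists (submxcol x' j), (submxcol l j); split=> //.
    exact: l0.
  by rewrite submxcolD HE.
move=> x' l Qx' /sub_ge0 l0; rewrite dot_blocks => /eqP.
rewrite psumr_eq0 => [/allP z j|j _]; last first.
  have [_ /(_ (submxcol (x' + H *m l) j))[_ dj] _] := sP j.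
  apply: dj; last exact: Ce.
  exists (submxcol x' j), (submxcol l j); split; [exact: Qx' | exact: l0 |].
  by rewrite submxcolD HE.
rewrite submxcolN; have [_ _ rec] := sP j.
apply: (rec _ (submxcol l j)); [exact: Qx' | exact: l0 |].
rewrite -HE -submxcolD; apply/eqP; exact: (z j (mem_index_enum _)).
Qed.

Lemma step2_choices : exists e es,
  step2_e (prod_cone C_) e /\ ri (dual_cone (prod_cone C_)) es.
Proof.
have ex j : exists e, (polyhedral (C_ j) -> e = 0) /\
                      (~ polyhedral (C_ j) -> ri (C_ j) e).
  have [p|np] := pselect (polyhedral (C_ j)); first by exists 0.
  by have [e re] := ri_nonempty (C_cone j); exists e.
have [es res] := ri_nonempty (dual_cone_ccone (prod_cone C_)).
exists (\mxcol_j sval (cid (ex j))), es; split=> //.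
by apply/step2_e_prod => j; rewrite mxcolK; exact: (svalP (cid (ex j))).
Qed.

(** Keeps the iterates of Step 4 in product form: a sum of nonnegative block terms is zero only
    termwise. *)
Lemma prod_orthogonal x : dual_cone (prod_cone C_) x ->
  prod_cone C_ `&` orthogonal_to x =
  prod_cone (fun j => C_ j `&` orthogonal_to (submxcol x j)).
Proof.
move=> /dual_prod Cx; apply/seteqP; split=> [y [Cy /= xy] j|y H].
  split; first exact: Cy.
  move/eqP: xy; rewrite /orthogonal_to /= dot_blocks.
  rewrite psumr_eq0 => [/allP/(_ j (mem_index_enum _))/eqP //|i _].
  by rewrite dotC; apply: Cx; exact: Cy.
split; first by move=> j; case: (H j).
by rewrite /orthogonal_to /= dot_blocks; apply: big1 => j _; case: (H j).
Qed.

End Product.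

(** * Correctness and termination of Phase 1 *)

Section Termination.
Context {R : realType} {r m : nat} {n_ : 'I_r -> nat}.
Local Notation N := (\sum_j n_ j)%N.
Variables (A : 'M[R]_(m, N)) (c : 'cV[R]_N).

Lemma always_stops_withW (Q Q' : outcome -> Prop) s :
  (forall o, Q o -> Q' o) ->
  always_stops_with A c Q s -> always_stops_with A c Q' s.
Proof.
move=> QQ'; elim=> [o /QQ'|s1 s2 st _ IH]; first exact: always_stopped.
exact: always_step st IH.
Qed.

Variable K_ : forall j, set 'cV[R]_(n_ j).
Arguments K_ : clear implicits.
Local Notation K := (prod_cone K_).
Local Notation bound := (\sum_j dist_poly (K_ j))%N.

(** One postcondition, stated without assuming feasibility or infeasibility: each kind of stop
    certifies which of the two holds, so all claims follow from it. *)
Definition correct_outcome (o : outcome) : Prop :=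
  match o with
  | Stop3 ds => ~ D_feasible A c K /\ (size ds <= 1 + bound)%N
  | Stop5 F s' ds =>
      [/\ face K F, Fmin A c K `<=` F, feasible_slacks A c K s',
          feasible_slacks A c F s' /\ ri_on_nonpoly F s' & PPS A c F] /\
      (size ds <= bound)%N
  end.

Lemma dot_slack x y : A *m x = 0 -> dot (slack A c y) x = dot c x.
Proof. by move=> Ax; rewrite /slack dotBl dot_mull trmxK Ax dot0r subr0. Qed.

Section Iteration.
Variable F_ : forall j, set 'cV[R]_(n_ j).
Arguments F_ : clear implicits.
Local Notation F := (prod_cone F_).
Hypothesis F_cone : forall j, ccone (F_ j).
Hypothesis slacks_F : feasible_slacks A c K `<=` F.

(** The optimal solutions of Step 2 are arbitrary; they share the values of the zero-gap pair built
    in [PC_DC_optimal]. *)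
Lemma optimal_value e es x t w y1 y2 y3 :
  step2_e F e -> ri (dual_cone F) es ->
  PC_optimal A c F e es (x, t, w) -> DC_optimal A c F e es (y1, y2, y3) ->
  t = y2.
Proof.
move=> He res [Px Pmin] [Dy Dmax].
have [k [Q [H [cQ FQ rec]]]] := dual_decomposition_prod F_cone He.
have [p [d [[Pp pmin] [Dd dmax] pd]]] :=
  @PC_DC_optimal R r m n_ A c _ e es _ _ H (prod_ccone F_cone) res
    (step2_e_mem F_cone He) cQ FQ rec.
have := Pmin _ Pp; have := pmin _ Px; have := Dmax _ Dd; have := dmax _ Dy.
rewrite /= pd; lra.
Qed.

Lemma infeasible_certificate x : dual_cone F x -> A *m x = 0 -> dot c x < 0 ->
  ~ D_feasible A c K.
Proof.
move=> Fx Ax cx [y Ky].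
have := Fx (slack A c y) (slacks_F (conj Ky (ex_intro _ y erefl))).
by rewrite dot_slack // leNgt cx.
Qed.

Lemma slacks_orthogonal x : A *m x = 0 -> dot c x = 0 ->
  feasible_slacks A c K `<=` F `&` orthogonal_to x.
Proof.
move=> Ax cx s Ks; split; first exact: slacks_F.
by case: Ks => _ [y ->]; rewrite /orthogonal_to /= dotC dot_slack.
Qed.

(** Since [y1 >= y2 > 0], dividing the constraint by [y1] writes the slack as a point of [F] plus a
    positive multiple of [e]; [ri_addr] concludes on nonpolyhedral blocks. *)
Lemma output_slack e es y1 y2 y3 : step2_e F e -> 0 < y2 ->
  DC_feasible A c F e es (y1, y2, y3) ->
  F (slack A c (y1^-1 *: y3)) /\ ri_on_nonpoly F (slack A c (y1^-1 *: y3)).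
Proof.
move=> He y2p [Fq _ y12].
have y1p : 0 < y1 by lra.
have [_ _ FD FZ] := prod_ccone F_cone.
have sE : slack A c (y1^-1 *: y3) =
    y1^-1 *: (y1 *: c - y2 *: e - A^T *m y3) + (y2 / y1) *: e.
  rewrite /slack -scalemxAr; apply/colP => i; rewrite !mxE; field.
  exact: lt0r_neq0.
have Fq' : F (y1^-1 *: (y1 *: c - y2 *: e - A^T *m y3)).
  by apply: FZ => //; rewrite invr_ge0 ltW.
have yy : 0 < y2 / y1 by rewrite divr_gt0.
rewrite sE; split.
  by apply: FD => //; apply: FZ; [exact: ltW | exact: step2_e_mem].
move=> j; rewrite (block_prod F_cone) submxcolD (submxcolZ (y2 / y1)) => npj.
have [_ /(_ npj) re] := (step2_e_prod F_cone e).1 He j.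
exact: ri_addr (F_cone j) (Fq' j) re yy.
Qed.

Lemma dist_poly_decrease e x : step2_e F e -> dual_cone F x -> dot e x = 1 ->
  (\sum_j dist_poly (F_ j `&` orthogonal_to (submxcol x j)) <
   \sum_j dist_poly (F_ j))%N.
Proof.
move=> He Fx ex; have /dual_prod Fxj := Fx.
have le j : (dist_poly (F_ j `&` orthogonal_to (submxcol x j)) <=
             dist_poly (F_ j))%N.
  have [fj cj] := face_orthogonal (F_cone j) (Fxj F_cone j).
  exact: dist_poly_face.
have [j exj] : exists j, dot (submxcol e j) (submxcol x j) != 0.
  apply: contrapT => H; have := ex; rewrite dot_blocks big1 => [|j _].
    by move=> /esym/eqP; rewrite oner_eq0.
  by apply/eqP; apply: contrapT => /negP h; apply: H; exists j.
have [p np] := (step2_e_prod F_cone e).1 He j.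
have npj : ~ polyhedral (F_ j).
  by move=> /p ej; rewrite ej dot0l eqxx in exj.
rewrite (bigD1 j) //= [ltnRHS](bigD1 j) //= -addSn leq_add //; last first.
  by apply: leq_sum => i _; exact: le.
have [fj cj] := face_orthogonal (F_cone j) (Fxj F_cone j).
apply: dist_poly_proper_face => //; apply/eqP => FE.
(* [e_j] belongs to [F_j] but is not orthogonal to [x_j], so the new face is proper. *)
have [Fe _] := np npj; move: Fe; rewrite -FE => -[_].
by rewrite /orthogonal_to /= dotC => /eqP; rewrite (negbTE exj).
Qed.

End Iteration.

(** Loop invariant, with strong induction on the sum [k] of the block distances: the iterate is a
    face of [K] and a product of cones, contains all feasible slacks, and the directions found so
    far plus [k] stay within the bound. *)
Lemma phase1_correct_from k (F_ : forall j, set 'cV[R]_(n_ j)) ds :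
  (forall j, ccone (F_ j)) -> face K (prod_cone F_) ->
  feasible_slacks A c K `<=` prod_cone F_ ->
  (\sum_j dist_poly (F_ j) = k)%N -> (size ds + k <= bound)%N ->
  always_stops_with A c correct_outcome (Iterate (prod_cone F_) ds).
Proof.
elim/ltn_ind: k F_ ds => k IH F_ ds cF fF sF kE szk.
(* [always_step] asks for one available move, hence the existence results, and then for a treatment
   of every possible move. *)
have [e0 [es0 [He0 res0]]] := step2_choices cF.
apply: (always_step (step2_choose _ _ _ res0 He0)) => s1 st1.
inversion st1 as [? ? e es res He| | | |]; subst; clear st1.
have [h [Q [H [cQ FQ rec]]]] := dual_decomposition_prod cF He.
have [p0 [d0 [Pp0 Dd0 _]]] :=
  @PC_DC_optimal R r m n_ A c _ e es _ _ H (prod_ccone cF) res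
    (step2_e_mem cF He) cQ FQ rec.
apply: (always_step (step2_solve _ Pp0 Dd0)) => s2 st2.
inversion st2 as [|? ? ? ? [[x t] w] [[y1 y2] y3] Pp Dd| | |]; subst; clear st2.
have tE := optimal_value cF He res Pp Dd.
have [[[Fx t0 w0] [E1 E2 E3]] _] := Pp.
have szd : (size ds <= bound)%N by rewrite (leq_trans _ szk) // leq_addr.
have [tp|tn] := ltP 0 t.
  apply: (always_step (step5 A c _ _ _ _ _ _ _ tp)) => s3 st3.
  inversion st3; subst; try lra.
  apply: always_stopped; split=> //.
  have [Fs ri_s] : prod_cone F_ (slack A c (y1^-1 *: y3)) /\
      ri_on_nonpoly (prod_cone F_) (slack A c (y1^-1 *: y3)).
    by apply: (output_slack cF He tp (es := es)); case: Dd.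
  have slF : feasible_slacks A c (prod_cone F_) (slack A c (y1^-1 *: y3)).
    by split=> //; exists (y1^-1 *: y3).
  split=> //.
  - by apply: smallest_sub.
  - by split; [case: fF => FK _ _; exact: FK | exists (y1^-1 *: y3)].
  - by exists (slack A c (y1^-1 *: y3)).
have {tn t0}tz : t = 0 by apply/eqP; rewrite eq_le tn t0.
have Ax : A *m x = 0 by rewrite tz scale0r subr0 in E3.
(* As [w >= 0], this leaves only [<c, x> < 0] or [<c, x> = 0], so Steps 3 to 5 are exhaustive. *)
have cx : dot c x = - w by move: E1; rewrite tz scale0r subr0 => E1; lra.
have [cx0|cx0] := ltP (dot c x) 0.
  apply: (always_step (step3 A _ _ _ _ tz cx0)) => s3 st3.
  inversion st3; subst; try lra.
  apply: always_stopped; split; first exact: infeasible_certificate Fx Ax cx0.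
  (* The direction found in Step 3 need not decrease the distances; it accounts for the extra 1. *)
  by rewrite size_rcons add1n ltnS.
have {}cx0 : dot c x = 0 by lra.
apply: (always_step (step4 A _ _ _ _ tz cx0)) => s3 st3.
inversion st3; subst; try lra.
(* Here [<c, x> = 0] gives [w = 0], and the normalization [<e, x> + w = 1] yields the strict
   decrease. *)
have ex : dot e x = 1 by lra.
rewrite (prod_orthogonal cF Fx).
have Fxj := (dual_prod cF x).1 Fx.
have dec := dist_poly_decrease cF He Fx ex.
apply: (IH _ dec) => //.
- by move=> j; case: (face_orthogonal (cF j) (Fxj j)).
- rewrite -prod_orthogonal //; apply: face_trans fF _.
  by case: (face_orthogonal (prod_ccone cF) Fx).
- by rewrite -prod_orthogonal //; exact: slacks_orthogonal.
- by rewrite size_rcons addSn -addnS (leq_trans _ szk) // leq_add2l.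
Qed.

Lemma phase1_correct : (forall j, closed_convex_cone (K_ j)) ->
  phase1 A c K correct_outcome.
Proof.
move=> cK; have cK' j : ccone (K_ j) by apply/closed_convex_coneP.
apply: (phase1_correct_from (k := bound)) => //.
- by apply: face_refl; exact: prod_ccone.
- by move=> s [].
Qed.

End Termination.

Theorem proposition8 (R : realType) (r m : nat) (n_ : 'I_r -> nat)
    (K_ : forall j : 'I_r, set 'cV[R]_(n_ j))
    (A : 'M[R]_(m, \sum_j n_ j)) (b : 'cV[R]_m) (c : 'cV[R]_(\sum_j n_ j))
    (K_cone : forall j : 'I_r, closed_convex_cone (K_ j)) :
  (D_feasible A c (prod_cone K_) ->
   phase1 A c (prod_cone K_) (fun o =>
     match o with
     | Stop3 _ => False
     | Stop5 F s' ds =>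
         [/\ face (prod_cone K_) F, Fmin A c (prod_cone K_) `<=` F,
             feasible_slacks A c (prod_cone K_) s',
             feasible_slacks A c F s' /\ ri_on_nonpoly F s' & PPS A c F] /\
         (size ds <= \sum_(j < r) dist_poly (K_ j))%N
     end)) /\
  phase1 A c (prod_cone K_) (fun o =>
    ~ D_feasible A c (prod_cone K_) <-> exists ds, o = Stop3 ds) /\
  (~ D_feasible A c (prod_cone K_) ->
   phase1 A c (prod_cone K_) (fun o =>
     (size (directions o) <= 1 + \sum_(j < r) dist_poly (K_ j))%N)).
Proof.
have H := phase1_correct A c K_cone.
(* Every claim is a weakening of [correct_outcome]: an outcome [Stop3] excludes feasibility, and
   [Stop5] exhibits a feasible slack. *)
split; [|split] => [Df| |nDf]; apply: always_stops_withW H => -[ds|F s' ds] //=.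
- by case.
- by case=> nDf _; split=> // _; exists ds.
- case=> [[_ _ [Ks [y sE]] _ _] _]; split=> [nDf|[]//].
  by case: nDf; exists y; rewrite -sE.
- by case.
- by case=> _ sz; rewrite (leq_trans sz) // leq_addl.
Qed.
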